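(* (i) For $\alpha\in[0,1)$, $R_{\mathcal{S}^*_{Ne}}(\mathcal{BS}^*(\alpha))=\dfrac{4}{3+\sqrt{9+16\alpha}}$. (ii) For $\alpha\in[0,1/3]$, $R_{\mathcal{S}^*_{Ne}}(\mathcal{S}^*_L(\alpha))=\dfrac{4(2-3\alpha)}{9(1-\alpha)^2}$; in particular $R_{\mathcal{S}^*_{Ne}}(\mathcal{S}^*_L)=8/9$. (iii) For $\alpha\in[0,(3e-5)/(3e-3)]$, $R_{\mathcal{S}^*_{Ne}}(\mathcal{S}^*_{\alpha,e})=\log\dfrac{5-3\alpha}{3-3\alpha}$; in particular $R_{\mathcal{S}^*_{Ne}}(\mathcal{S}^*_e)=\log(5/3)$. Each radius is sharp, i.e. it is the exact value of the radius.
   Context: $\mathbb{D}=\{|z|<1\}$, $\mathbb{D}_r=\{|z|<r\}$. $\mathcal{A}$ is the class of analytic $f$ on $\mathbb{D}$ with $f(0)=0$, $f'(0)=1$; for $f\in\mathcal{A}$ let $\mathcal{Q}_f(z)=zf'(z)/f(z)$. For analytic $F,G$ on $\mathbb{D}$, $F\prec G$ means $F=G\circ w$ for some analytic $w:\mathbb{D}\to\mathbb{D}$ with $w(0)=0$. For analytic $\varphi$ on $\mathbb{D}$, $\mathcal{S}^*(\varphi)=\{f\in\mathcal{A}:\mathcal{Q}_f\prec\varphi\}$. Let $\varphi_{Ne}(z)=1+z-z^3/3$ (univalent on $\mathbb{D}$), $\Omega_{Ne}=\varphi_{Ne}(\mathbb{D})$, $\mathcal{S}^*_{Ne}=\mathcal{S}^*(\varphi_{Ne})$.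 For $\mathcal{G}\subset\mathcal{A}$, $R_{\mathcal{S}^*_{Ne}}(\mathcal{G})$ is the largest $\rho\in(0,1]$ such that $\mathcal{Q}_f(\mathbb{D}_\rho)\subseteq\Omega_{Ne}$ for all $f\in\mathcal{G}$ (equivalently $r^{-1}f(rz)\in\mathcal{S}^*_{Ne}$ for all $f\in\mathcal{G}$, $0<r\le\rho$). Classes (with $0\le\alpha<1$, principal branch of the square root): $\mathcal{BS}^*(\alpha)=\mathcal{S}^*\big(1+\frac{z}{1-\alpha z^2}\big)$; $\mathcal{S}^*_L(\alpha)=\mathcal{S}^*\big(\alpha+(1-\alpha)\sqrt{1+z}\big)$, $\mathcal{S}^*_L=\mathcal{S}^*_L(0)$; $\mathcal{S}^*_{\alpha,e}=\mathcal{S}^*\big(\alpha+(1-\alpha)e^z\big)$, $\mathcal{S}^*_e=\mathcal{S}^*_{0,e}$. *)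

(* Defs.v *)
From Stdlib Require Import Reals Lra.
Open Scope R_scope.

Definition C : Type := (R * R)%type.
Definition RtoC (x : R) : C := (x, 0).
Definition C0 : C := (0, 0).
Definition C1 : C := (1, 0).
Definition Cadd (z w : C) : C := (fst z + fst w, snd z + snd w).
Definition Copp (z : C) : C := (- fst z, - snd z).
Definition Csub (z w : C) : C := Cadd z (Copp w).
Definition Cmul (z w : C) : C :=
  (fst z * fst w - snd z * snd w, fst z * snd w + snd z * fst w).
Definition Cinv (z : C) : C :=
  (fst z / (fst z ^ 2 + snd z ^ 2), - snd z / (fst z ^ 2 + snd z ^ 2)).
Definition Cdiv (z w : C) : C := Cmul z (Cinv w).
Definition Cnorm (z : C) : R := sqrt (fst z ^ 2 + snd z ^ 2).

Definition Cexp (z : C) : C := (exp (fst z) * cos (snd z), exp (fst z) * sin (snd z)).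

(** principal branch of the square root (Re >= 0; on the negative real axis
    the value i*sqrt(|x|) is chosen) *)
Definition Csqrt (z : C) : C :=
  (sqrt ((Cnorm z + fst z) / 2),
   (if Rlt_dec (snd z) 0 then -1 else 1) * sqrt ((Cnorm z - fst z) / 2)).

Definition has_cderiv (f : C -> C) (z L : C) : Prop :=
  forall eps : R, 0 < eps -> exists delta : R, 0 < delta /\
    forall h : C, h <> C0 -> Cnorm h < delta ->
      Cnorm (Csub (Cdiv (Csub (f (Cadd z h)) (f z)) h) L) < eps.

Definition analytic_on_D (f : C -> C) : Prop :=
  forall z : C, Cnorm z < 1 -> exists L : C, has_cderiv f z L.

Definition classA (f : C -> C) : Prop :=
  analytic_on_D f /\ f C0 = C0 /\ has_cderiv f C0 C1.

Definition Qf_at (f : C -> C) (z q : C) : Prop :=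
  f z <> C0 /\ forall L : C, has_cderiv f z L -> Cdiv (Cmul z L) (f z) = q.

(** f \in S*(phi) iff f \in A and Q_f = phi o w on D for a Schwarz function w
    (analytic w : D -> D, w(0) = 0).  At z = 0 both sides equal
    Q_f(0) = 1 = phi(0) for the phi considered below, so the identity is
    imposed on D \ {0}, where Q_f is given by its formula (and f must not
    vanish there, Q_f being analytic on D). *)
Definition starlike_wrt (phi : C -> C) (f : C -> C) : Prop :=
  classA f /\
  exists w : C -> C,
    analytic_on_D w /\ (forall z, Cnorm z < 1 -> Cnorm (w z) < 1) /\ w C0 = C0 /\
    forall z : C, Cnorm z < 1 -> z <> C0 -> Qf_at f z (phi (w z)).

Definition phi_Ne (z : C) : C :=
  Csub (Cadd C1 z) (Cdiv (Cmul z (Cmul z z)) (RtoC 3)).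
Definition Omega_Ne (q : C) : Prop := exists z : C, Cnorm z < 1 /\ q = phi_Ne z.

Definition phi_BS (alpha : R) (z : C) : C :=
  Cadd C1 (Cdiv z (Csub C1 (Cmul (RtoC alpha) (Cmul z z)))).
Definition phi_L (alpha : R) (z : C) : C :=
  Cadd (RtoC alpha) (Cmul (RtoC (1 - alpha)) (Csqrt (Cadd C1 z))).
Definition phi_e (alpha : R) (z : C) : C :=
  Cadd (RtoC alpha) (Cmul (RtoC (1 - alpha)) (Cexp z)).

Definition BS_star (alpha : R) := starlike_wrt (phi_BS alpha).
Definition SL_star (alpha : R) := starlike_wrt (phi_L alpha).
Definition Se_star (alpha : R) := starlike_wrt (phi_e alpha).

(** Q_f(D_rho) is contained in Omega_Ne.  (Q_f(0) = 1 = phi_Ne(0) lies in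
    Omega_Ne, so only the punctured disk needs a condition.) *)
Definition Qf_maps_into_Ne (f : C -> C) (rho : R) : Prop :=
  forall z : C, Cnorm z < rho -> z <> C0 ->
    f z <> C0 /\
    forall L : C, has_cderiv f z L -> Omega_Ne (Cdiv (Cmul z L) (f z)).

Definition is_Ne_radius (G : (C -> C) -> Prop) (r : R) : Prop :=
  0 < r <= 1 /\
  (forall f, G f -> Qf_maps_into_Ne f r) /\
  (forall rho : R, r < rho <= 1 -> exists f, G f /\ ~ Qf_maps_into_Ne f rho).

(* Main.v *)
Require Import Defs.
From Stdlib Require Import Reals Lra Psatz Classical ClassicalEpsilon.
From Coquelicot Require Import Coquelicot.
Open Scope R_scope.

(** By the Schwarz lemma, [Q_f = phi o w] maps the disc of radius [r] into
    [phi (D_r)], so the radius is at least [r] as soon as [phi (D_r)] lies in the disc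
    [|q - 1| < 2/3], which is contained in [Omega_Ne].  Each of the three [phi] attains
    the largest value of [|phi z - 1|] on [|z| = r] at a real point, where it equals [2/3]
    for the stated [r].  Since [Omega_Ne] meets the real axis exactly in
    [(1 - 2/3, 1 + 2/3)], the function [f] with [Q_f = phi] shows that this is sharp.

    Both the Schwarz lemma (through a mean value property on circles) and the existence
    of that [f] (through a primitive of [(phi z - 1) / z]) rest on Goursat's theorem for
    rectangles, proved by bisection for real forms [P dx + Q dy].  Complex
    differentiability is pointwise, so no continuity of the derivative is available. *)

(** * Goursat's theorem for closed real forms *)

(** The constant 2/3 is the value of z - z^3/3 at its critical point 1; the points 1 and -1 give the
    cusps 1 + 2/3 and 1 - 2/3 of the nephroid. The radii solve r/(1 - alpha r^2) = 2/3, (1 -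
    alpha)(1 - sqrt(1 - r)) = 2/3 and (1 - alpha)(e^r - 1) = 2/3; the extremal point is r in the
    first and third case and -r in the second. The upper bounds on alpha in the last two cases say
    that the solution does not exceed 1. The obstacle is the maximum principle for w(z)/z, a
    quotient known to be merely continuous at the origin. Neither Cauchy's integral formula nor
    power series are used: a maximum of the modulus is turned into a strict maximum of the real part
    of a holomorphic function, which is refuted by comparing its means over two concentric circles.
    Bisection of rectangles provides both Goursat's theorem and the existence of maxima on closed
    discs. *)

Lemma nested_intervals (u v : nat -> R) :
  (forall k, u k <= u (S k)) -> (forall k, v (S k) <= v k) ->
  (forall k, u k <= v k) ->
  exists x, forall k, u k <= x <= v k.
Proof.
intros Hu Hv Huv.
assert (Mu : forall k n, u k <= u (k + n)%nat).
{ intros k n. induction n as [|n IH].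
  - rewrite Nat.add_0_r. lra.
  - rewrite Nat.add_succ_r. specialize (Hu (k + n)%nat). lra. }
assert (Mv : forall k n, v (k + n)%nat <= v k).
{ intros k n. induction n as [|n IH].
  - rewrite Nat.add_0_r. lra.
  - rewrite Nat.add_succ_r. specialize (Hv (k + n)%nat). lra. }
assert (Huv2 : forall k n, u k <= v n).
{ intros k n. specialize (Mu k n). specialize (Mv n k).
  specialize (Huv (k + n)%nat). rewrite Nat.add_comm in Mv. lra. }
destruct (completeness (fun t => exists k, t = u k)) as [x [Hx1 Hx2]].
- exists (v 0%nat). intros t [k ->]. apply Huv2.
- now exists (u 0%nat), 0%nat.
- exists x. intros k. split.
  + apply Hx1. now exists k.
  + apply Hx2. intros t [n ->]. apply Huv2.
Qed.

(** Choosing a bad quarter over and over yields nested rectangles, whose sides close in on a common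
    point. [Bad] stays abstract because it is used twice: for loop integrals that are too large, and
    for rectangles on which a function comes up to all its values. *)
Lemma bisection (Bad : R -> R -> R -> R -> Prop) (a b c d : R) :
  a <= b -> c <= d -> Bad a b c d ->
  (forall a b c d, a <= b -> c <= d -> Bad a b c d ->
     Bad a ((a + b) / 2) c ((c + d) / 2) \/ Bad ((a + b) / 2) b c ((c + d) / 2) \/
     Bad a ((a + b) / 2) ((c + d) / 2) d \/ Bad ((a + b) / 2) b ((c + d) / 2) d) ->
  exists x y, a <= x <= b /\ c <= y <= d /\
    forall k : nat, exists a' b' c' d',
      a' <= x <= b' /\ c' <= y <= d' /\
      b' - a' = (b - a) / 2 ^ k /\ d' - c' = (d - c) / 2 ^ k /\ Bad a' b' c' d'.
Proof.
intros Hab Hcd H0 Hstep.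
pose (wf := fun r : (R * R) * (R * R) =>
  fst (fst r) <= snd (fst r) /\ fst (snd r) <= snd (snd r) /\
  Bad (fst (fst r)) (snd (fst r)) (fst (snd r)) (snd (snd r))).
pose (half := fun r q : (R * R) * (R * R) =>
  fst (fst r) <= fst (fst q) /\ snd (fst q) <= snd (fst r) /\
  fst (snd r) <= fst (snd q) /\ snd (snd q) <= snd (snd r) /\
  snd (fst q) - fst (fst q) = (snd (fst r) - fst (fst r)) / 2 /\
  snd (snd q) - fst (snd q) = (snd (snd r) - fst (snd r)) / 2).
(* [wf r] stands under the existential so that choice produces a total function [next]; for an
   ill-formed [r] any witness will do. *)
assert (Hex : forall r, exists q, wf r -> wf q /\ half r q).
{ intros [[p q] [s t]].
  destruct (classic (wf ((p, q), (s, t)))) as [[H1 [H2 H3]]|N].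
  2: { exists ((p, q), (s, t)). intros W. contradiction. }
  simpl in H1, H2, H3.
  destruct (Hstep p q s t H1 H2 H3) as [B|[B|[B|B]]].
  - exists ((p, (p + q) / 2), (s, (s + t) / 2)). intros _.
    unfold wf, half; simpl. repeat split; try assumption; lra.
  - exists (((p + q) / 2, q), (s, (s + t) / 2)). intros _.
    unfold wf, half; simpl. repeat split; try assumption; lra.
  - exists ((p, (p + q) / 2), ((s + t) / 2, t)). intros _.
    unfold wf, half; simpl. repeat split; try assumption; lra.
  - exists (((p + q) / 2, q), ((s + t) / 2, t)). intros _.
    unfold wf, half; simpl. repeat split; try assumption; lra. }
pose (next := fun r => proj1_sig (constructive_indefinite_description _ (Hex r))).
assert (Hnext : forall r, wf r -> wf (next r) /\ half r (next r)).
{ intros r. exact (proj2_sig (constructive_indefinite_description _ (Hex r))). }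
pose (r := nat_rect (fun _ => ((R * R) * (R * R))%type) ((a, b), (c, d)) (fun _ q => next q)).
assert (Hr : forall k, wf (r k)).
{ intros k. induction k as [|k IH].
  - unfold wf; simpl. auto.
  - exact (proj1 (Hnext _ IH)). }
assert (Hh : forall k, half (r k) (r (S k))).
{ intros k. exact (proj2 (Hnext _ (Hr k))). }
destruct (nested_intervals (fun k => fst (fst (r k))) (fun k => snd (fst (r k)))) as [x Hx].
{ intros k. apply (Hh k). }
{ intros k. apply (Hh k). }
{ intros k. apply (Hr k). }
destruct (nested_intervals (fun k => fst (snd (r k))) (fun k => snd (snd (r k)))) as [y Hy].
{ intros k. apply (Hh k). }
{ intros k. apply (Hh k). }
{ intros k. apply (Hr k). }
exists x, y.
split; [exact (Hx 0%nat)|split; [exact (Hy 0%nat)|]].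
intros k.
exists (fst (fst (r k))), (snd (fst (r k))), (fst (snd (r k))), (snd (snd (r k))).
split; [exact (Hx k)|split; [exact (Hy k)|]].
assert (Hl : snd (fst (r k)) - fst (fst (r k)) = (b - a) / 2 ^ k /\
             snd (snd (r k)) - fst (snd (r k)) = (d - c) / 2 ^ k).
{ induction k as [|k [IH1 IH2]].
  - simpl. split; field.
  - destruct (Hh k) as (_ & _ & _ & _ & E1 & E2). rewrite E1, E2, IH1, IH2.
    simpl. split; field; apply pow_nonzero; lra. }
destruct Hl as [L1 L2]. repeat split; try assumption. apply (Hr k).
Qed.

Lemma pow_half_small (l eps : R) : 0 < eps -> exists k : nat, l / 2 ^ k < eps.
Proof.
intros He.
destruct (pow_lt_1_zero (/ 2)) with (y := eps / (Rabs l + 1)) as [k Hk].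
- rewrite Rabs_pos_eq; lra.
- apply Rdiv_lt_0_compat; [lra|]. pose proof (Rabs_pos l); lra.
- exists k. specialize (Hk k (le_n k)).
  rewrite <- RPow_abs, Rabs_pos_eq in Hk by lra.
  rewrite pow_inv in Hk. unfold Rdiv.
  pose proof (Rabs_pos l) as Pl. pose proof (Rle_abs l) as Ll.
  assert (Pk : 0 < / 2 ^ k) by (apply Rinv_0_lt_compat, pow_lt; lra).
  apply Rle_lt_trans with ((Rabs l + 1) * / 2 ^ k); [nra|].
  apply Rmult_lt_compat_l with (r := Rabs l + 1) in Hk; [|lra].
  replace ((Rabs l + 1) * (eps / (Rabs l + 1))) with eps in Hk by (field; lra).
  exact Hk.
Qed.

(* Closedness of [P dx + Q dy] at a point: the shared [b] is both [dP/dy] and [dQ/dx]. *)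
Definition closed_at (P Q : R -> R -> R) (x y : R) : Prop :=
  exists a b c, differentiable_pt_lim P x y a b /\ differentiable_pt_lim Q x y b c.

Lemma closed_at_cont1 P Q x y : closed_at P Q x y -> continuity_2d_pt P x y.
Proof.
intros (a & b & c & H & _). apply differentiable_continuity_pt. now exists a, b.
Qed.

Lemma closed_at_cont2 P Q x y : closed_at P Q x y -> continuity_2d_pt Q x y.
Proof.
intros (a & b & c & _ & H). apply differentiable_continuity_pt. now exists b, c.
Qed.

Lemma continuity_2d_slice_x (f : R -> R -> R) (x y : R) :
  continuity_2d_pt f x y -> continuous (fun t => f t y) x.
Proof.
intros H. apply continuity_pt_filterlim.
apply continuity_pt_locally. intros eps. destruct (H eps) as [d Hd].
exists d. intros t Ht. apply Hd; [exact Ht|].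
rewrite Rminus_diag, Rabs_R0. apply cond_pos.
Qed.

Lemma continuity_2d_slice_y (f : R -> R -> R) (x y : R) :
  continuity_2d_pt f x y -> continuous (fun t => f x t) y.
Proof.
intros H. apply continuity_pt_filterlim.
apply continuity_pt_locally. intros eps. destruct (H eps) as [d Hd].
exists d. intros t Ht. apply Hd; [|exact Ht].
rewrite Rminus_diag, Rabs_R0. apply cond_pos.
Qed.

(** The integral of P dx + Q dy along the counterclockwise boundary of [a, b] x [c, d]. *)
Definition loop_integral (P Q : R -> R -> R) (a b c d : R) : R :=
  RInt (fun t => P t c) a b + RInt (fun t => Q b t) c d
  - RInt (fun t => P t d) a b - RInt (fun t => Q a t) c d.

Lemma ex_RInt_slice_x_oriented (f : R -> R -> R) a b y :
  (forall t, Rmin a b <= t <= Rmax a b -> continuity_2d_pt f t y) ->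
  ex_RInt (fun t => f t y) a b.
Proof.
intros H. apply (ex_RInt_continuous (V := R_CompleteNormedModule)).
intros z Hz. apply (continuity_2d_slice_x f z y), H, Hz.
Qed.

Lemma ex_RInt_slice_y_oriented (f : R -> R -> R) a b x :
  (forall t, Rmin a b <= t <= Rmax a b -> continuity_2d_pt f x t) ->
  ex_RInt (fun t => f x t) a b.
Proof.
intros H. apply (ex_RInt_continuous (V := R_CompleteNormedModule)).
intros z Hz. apply (continuity_2d_slice_y f x z), H, Hz.
Qed.

Lemma ex_RInt_slice_x (f : R -> R -> R) a b y :
  a <= b -> (forall t, a <= t <= b -> continuity_2d_pt f t y) ->
  ex_RInt (fun t => f t y) a b.
Proof.
intros Hab H. apply ex_RInt_slice_x_oriented.
rewrite Rmin_left, Rmax_right by exact Hab. exact H.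
Qed.

Lemma ex_RInt_slice_y (f : R -> R -> R) a b x :
  a <= b -> (forall t, a <= t <= b -> continuity_2d_pt f x t) ->
  ex_RInt (fun t => f x t) a b.
Proof.
intros Hab H. apply ex_RInt_slice_y_oriented.
rewrite Rmin_left, Rmax_right by exact Hab. exact H.
Qed.

Lemma RInt_Chasles_R (f : R -> R) a b c :
  ex_RInt f a b -> ex_RInt f b c -> RInt f a c = RInt f a b + RInt f b c.
Proof. intros H1 H2. symmetry. exact (RInt_Chasles f a b c H1 H2). Qed.

Lemma loop_integral_split_x P Q a m b c d :
  a <= m <= b -> c <= d ->
  (forall x y, a <= x <= b -> c <= y <= d -> closed_at P Q x y) ->
  loop_integral P Q a b c d = loop_integral P Q a m c d + loop_integral P Q m b c d.
Proof.
intros Hm Hcd H. unfold loop_integral.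
rewrite (RInt_Chasles_R (fun t => P t c) a m b), (RInt_Chasles_R (fun t => P t d) a m b).
- ring.
- apply ex_RInt_slice_x; [lra|]. intros t Ht. apply (closed_at_cont1 P Q), H; lra.
- apply ex_RInt_slice_x; [lra|]. intros t Ht. apply (closed_at_cont1 P Q), H; lra.
- apply ex_RInt_slice_x; [lra|]. intros t Ht. apply (closed_at_cont1 P Q), H; lra.
- apply ex_RInt_slice_x; [lra|]. intros t Ht. apply (closed_at_cont1 P Q), H; lra.
Qed.

Lemma loop_integral_split_y P Q a b c m d :
  a <= b -> c <= m <= d ->
  (forall x y, a <= x <= b -> c <= y <= d -> closed_at P Q x y) ->
  loop_integral P Q a b c d = loop_integral P Q a b c m + loop_integral P Q a b m d.
Proof.
intros Hab Hm H. unfold loop_integral.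
rewrite (RInt_Chasles_R (fun t => Q a t) c m d), (RInt_Chasles_R (fun t => Q b t) c m d).
- ring.
- apply ex_RInt_slice_y; [lra|]. intros t Ht. apply (closed_at_cont2 P Q), H; lra.
- apply ex_RInt_slice_y; [lra|]. intros t Ht. apply (closed_at_cont2 P Q), H; lra.
- apply ex_RInt_slice_y; [lra|]. intros t Ht. apply (closed_at_cont2 P Q), H; lra.
- apply ex_RInt_slice_y; [lra|]. intros t Ht. apply (closed_at_cont2 P Q), H; lra.
Qed.

(** The subtracted term is the exact integral of the affine function, with primitive p u + q (u -
    x)^2 / 2, so only the error [M] is integrated. *)
Lemma RInt_near_affine (f : R -> R) (s t p q x M : R) :
  s <= t -> ex_RInt f s t ->
  (forall u, s <= u <= t -> Rabs (f u - (p + q * (u - x))) <= M) ->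
  Rabs (RInt f s t - (p * (t - s) + q * ((t - x) ^ 2 - (s - x) ^ 2) / 2)) <= (t - s) * M.
Proof.
intros Hst Hf HM.
assert (HA : is_RInt (fun u => p + q * (u - x)) s t
               (p * (t - s) + q * ((t - x) ^ 2 - (s - x) ^ 2) / 2)).
{ replace (p * (t - s) + q * ((t - x) ^ 2 - (s - x) ^ 2) / 2) with
    (minus (p * t + q * (t - x) ^ 2 / 2) (p * s + q * (s - x) ^ 2 / 2))
    by (unfold minus, plus, opp; simpl; field).
  apply (is_RInt_derive (V := R_CompleteNormedModule) (fun u => p * u + q * (u - x) ^ 2 / 2)).
  - intros u _. auto_derive; [exact I|]. field.
  - intros u _. apply (ex_derive_continuous (V := R_NormedModule)). auto_derive. exact I. }
assert (E : RInt (fun u => f u - (p + q * (u - x))) s t =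
            RInt f s t - (p * (t - s) + q * ((t - x) ^ 2 - (s - x) ^ 2) / 2)).
{ apply is_RInt_unique.
  apply (is_RInt_minus f (fun u => p + q * (u - x)) s t); [|exact HA].
  apply (RInt_correct (V := R_CompleteNormedModule)), Hf. }
rewrite <- E. apply abs_RInt_le_const; [exact Hst| |exact HM].
apply (ex_RInt_minus f (fun u => p + q * (u - x))); [exact Hf|].
eexists; exact HA.
Qed.

Lemma goursat (P Q : R -> R -> R) (a b c d : R) :
  a <= b -> c <= d ->
  (forall x y, a <= x <= b -> c <= y <= d -> closed_at P Q x y) ->
  loop_integral P Q a b c d = 0.
Proof.
intros Hab Hcd H.
destruct (Req_dec (loop_integral P Q a b c d) 0) as [E|N]; [exact E|exfalso].
(* Degenerate rectangles are settled here, since the area [S0] becomes a denominator below. *)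
destruct Hab as [Hab|<-].
2: { apply N. unfold loop_integral. rewrite !RInt_point. unfold zero; simpl. ring. }
destruct Hcd as [Hcd|<-].
2: { apply N. unfold loop_integral. rewrite !RInt_point. unfold zero; simpl. ring. }
apply Rabs_pos_lt in N.
set (J := Rabs (loop_integral P Q a b c d)) in *.
set (S0 := (b - a) * (d - c)).
assert (HS : 0 < S0) by (apply Rmult_lt_0_compat; lra).
(* A bad rectangle carries at least the share of [J] proportional to its area. Area and loop
   integral are both additive, so the four quarters cannot all fall below their shares. *)
pose (Bad := fun p q s t => a <= p /\ q <= b /\ c <= s /\ t <= d /\
  J / S0 * ((q - p) * (t - s)) <= Rabs (loop_integral P Q p q s t)).
destruct (bisection Bad a b c d) as (x & y & Hx & Hy & Hk); try lra.
- unfold Bad. fold S0 J. repeat split; try lra.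
  apply Req_le. field. lra.
- intros p q s t Hpq Hst (B1 & B2 & B3 & B4 & B5).
  assert (Hin : forall x y, p <= x <= q -> s <= y <= t -> closed_at P Q x y).
  { intros x y Hx Hy. apply H; lra. }
  set (m := (p + q) / 2) in *. set (n := (s + t) / 2) in *.
  assert (Hm : p <= m <= q) by (unfold m; lra).
  assert (Hn : s <= n <= t) by (unfold n; lra).
  rewrite (loop_integral_split_x P Q p m q s t) in B5 by (lra || exact Hin).
  rewrite (loop_integral_split_y P Q p m s n t) in B5
    by (try lra; intros; apply Hin; lra).
  rewrite (loop_integral_split_y P Q m q s n t) in B5
    by (try lra; intros; apply Hin; lra).
  set (J1 := loop_integral P Q p m s n) in *. set (J2 := loop_integral P Q p m n t) in *.
  set (J3 := loop_integral P Q m q s n) in *. set (J4 := loop_integral P Q m q n t) in *.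
  assert (T : Rabs (J1 + J2 + (J3 + J4)) <= Rabs J1 + Rabs J2 + Rabs J3 + Rabs J4).
  { pose proof (Rabs_triang (J1 + J2) (J3 + J4)).
    pose proof (Rabs_triang J1 J2). pose proof (Rabs_triang J3 J4). lra. }
  assert (D : J / S0 * ((q - p) * (t - s)) =
     J / S0 * ((m - p) * (n - s)) + J / S0 * ((m - p) * (t - n)) +
     J / S0 * ((q - m) * (n - s)) + J / S0 * ((q - m) * (t - n))) by ring.
  unfold Bad. fold J1 J2 J3 J4.
  destruct (Rle_lt_dec (J / S0 * ((m - p) * (n - s))) (Rabs J1)) as [?|?].
  { left. repeat split; lra. }
  destruct (Rle_lt_dec (J / S0 * ((q - m) * (n - s))) (Rabs J3)) as [?|?].
  { right; left. repeat split; lra. }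
  destruct (Rle_lt_dec (J / S0 * ((m - p) * (t - n))) (Rabs J2)) as [?|?].
  { right; right; left. repeat split; lra. }
  right; right; right. repeat split; lra.
- destruct (H x y Hx Hy) as (p1 & p2 & p3 & HP & HQ).
  (* The affine parts of [P] and [Q] at [(x, y)] contribute nothing to the loop integral,
     so on the [k]-th rectangle it is [O(eps)] times the area. *)
  set (l := Rmax (b - a) (d - c)).
  assert (Hl1 : b - a <= l) by apply Rmax_l.
  assert (Hl2 : d - c <= l) by apply Rmax_r.
  (* The four edges give an error of at most 4 eps lk^2, which with this [eps] is J / (2 4^k): half
     of the share J / 4^k that the k-th rectangle must carry. *)
  set (eps := J / (8 * l ^ 2)).
  assert (He : 0 < eps).
  { apply Rdiv_lt_0_compat; [exact N|]. apply Rmult_lt_0_compat; [lra|]. apply pow_lt. lra. }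
  destruct (HP (mkposreal eps He)) as [d1 HP1]. destruct (HQ (mkposreal eps He)) as [d2 HQ1].
  simpl in HP1, HQ1.
  destruct (pow_half_small l (Rmin d1 d2)) as [k Hkl].
  { apply Rmin_pos; apply cond_pos. }
  pose proof (Rmin_l d1 d2) as M1. pose proof (Rmin_r d1 d2) as M2.
  destruct (Hk k) as (p & q & s & t & Hpx & Hsy & L1 & L2 & (B1 & B2 & B3 & B4 & B5)).
  set (lk := l / 2 ^ k) in *.
  assert (P2 : 0 < / 2 ^ k) by (apply Rinv_0_lt_compat, pow_lt; lra).
  assert (L1' : q - p <= lk) by (rewrite L1; unfold lk, Rdiv; nra).
  assert (L2' : t - s <= lk) by (rewrite L2; unfold lk, Rdiv; nra).
  assert (Hlk : 0 < lk) by (unfold lk, Rdiv; apply Rmult_lt_0_compat; lra).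
  assert (EP : forall u v, p <= u <= q -> s <= v <= t ->
     Rabs (P u v - P x y - (p1 * (u - x) + p2 * (v - y))) <= eps * lk).
  { intros u v Hu Hv.
    assert (X1 : Rabs (u - x) <= lk) by (apply Rabs_le; lra).
    assert (X2 : Rabs (v - y) <= lk) by (apply Rabs_le; lra).
    eapply Rle_trans; [apply HP1; lra|].
    apply Rmult_le_compat_l; [lra|]. apply Rmax_lub; assumption. }
  assert (EQ : forall u v, p <= u <= q -> s <= v <= t ->
     Rabs (Q u v - Q x y - (p2 * (u - x) + p3 * (v - y))) <= eps * lk).
  { intros u v Hu Hv.
    assert (X1 : Rabs (u - x) <= lk) by (apply Rabs_le; lra).
    assert (X2 : Rabs (v - y) <= lk) by (apply Rabs_le; lra).
    eapply Rle_trans; [apply HQ1; lra|].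
    apply Rmult_le_compat_l; [lra|]. apply Rmax_lub; assumption. }
  assert (XP : forall v, s <= v <= t -> ex_RInt (fun u => P u v) p q).
  { intros v Hv. apply ex_RInt_slice_x; [lra|]. intros u Hu.
    apply (closed_at_cont1 P Q), H; lra. }
  assert (XQ : forall u, p <= u <= q -> ex_RInt (fun v => Q u v) s t).
  { intros u Hu. apply ex_RInt_slice_y; [lra|]. intros v Hv.
    apply (closed_at_cont2 P Q), H; lra. }
  assert (IP : forall v, s <= v <= t ->
    Rabs (RInt (fun u => P u v) p q -
      ((P x y + p2 * (v - y)) * (q - p) + p1 * ((q - x) ^ 2 - (p - x) ^ 2) / 2))
    <= (q - p) * (eps * lk)).
  { intros v Hv. apply RInt_near_affine; [lra|apply XP, Hv|].
    intros u Hu. eapply Rle_trans; [|apply (EP u v Hu Hv)].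
    apply Req_le. f_equal. ring. }
  assert (IQ : forall u, p <= u <= q ->
    Rabs (RInt (fun v => Q u v) s t -
      ((Q x y + p2 * (u - x)) * (t - s) + p3 * ((t - y) ^ 2 - (s - y) ^ 2) / 2))
    <= (t - s) * (eps * lk)).
  { intros u Hu. apply RInt_near_affine; [lra|apply XQ, Hu|].
    intros v Hv. eapply Rle_trans; [|apply (EQ u v Hu Hv)].
    apply Req_le. f_equal. ring. }
  assert (A1 := IP s). assert (A2 := IP t). assert (A3 := IQ p). assert (A4 := IQ q).
  specialize (A1 ltac:(lra)). specialize (A2 ltac:(lra)).
  specialize (A3 ltac:(lra)). specialize (A4 ltac:(lra)).
  assert (Hel : 0 < eps * lk) by (apply Rmult_lt_0_compat; assumption).
  assert (U : Rabs (loop_integral P Q p q s t) <= 4 * (lk * (eps * lk))).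
  { assert (W1 : (q - p) * (eps * lk) <= lk * (eps * lk)) by (apply Rmult_le_compat_r; lra).
    assert (W2 : (t - s) * (eps * lk) <= lk * (eps * lk)) by (apply Rmult_le_compat_r; lra).
    unfold loop_integral.
    apply Rabs_le_between in A1. apply Rabs_le_between in A2.
    apply Rabs_le_between in A3. apply Rabs_le_between in A4.
    (* The terms in [p1] and [p3] agree on opposite edges and cancel; the mixed terms cancel because
       the same [p2] occurs in [P] and [Q], which is where closedness enters. *)
    assert (Z : (P x y + p2 * (s - y)) * (q - p) + (Q x y + p2 * (q - x)) * (t - s)
       - (P x y + p2 * (t - y)) * (q - p) - (Q x y + p2 * (p - x)) * (t - s) = 0) by ring.
    apply Rabs_le. lra. }
  assert (F : J / S0 * ((q - p) * (t - s)) = 2 * (4 * (lk * (eps * lk)))).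
  { rewrite L1, L2. unfold lk, eps, S0. field.
    repeat split; try lra. apply pow_nonzero; lra. }
  assert (0 < lk * (eps * lk)) by (apply Rmult_lt_0_compat; assumption).
  lra.
Qed.

(** * Complex derivatives *)

(** Division-free form of [has_cderiv] in which h = 0 is allowed; in the chain rule the increment of
    the inner function may vanish. *)
Definition cdiff (f : C -> C) (z L : C) : Prop :=
  forall eps, 0 < eps -> exists delta, 0 < delta /\
    forall h, Cmod h < delta ->
      Cmod (f (z + h) - f z - L * h)%C <= eps * Cmod h.

Lemma Cplus_sub_cancel_l (z h : C) : (z + h - z)%C = h.
Proof. ring. Qed.

Lemma RtoC_neq_0 (x : R) : 0 < x -> RtoC x <> 0%C.
Proof. intros Hx E. apply (f_equal fst) in E. simpl in E. lra. Qed.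

(* The type [C] and its operations in [Defs] are convertible to Coquelicot's. *)
Lemma has_cderiv_cdiff (f : C -> C) (z L : C) : has_cderiv f z L <-> cdiff f z L.
Proof.
split.
- intros H eps He. destruct (H eps He) as [d [Hd H1]].
  exists d. split; [exact Hd|]. intros h Hh.
  destruct (classic (h = 0%C)) as [->|N].
  + replace (f (z + 0) - f z - L * 0)%C with (RtoC 0).
    * rewrite Cmod_0. lra.
    * rewrite Cplus_0_r. ring.
  + specialize (H1 h N Hh).
    change (Cmod ((f (z + h) - f z) / h - L)%C < eps) in H1.
    replace (f (z + h) - f z - L * h)%C with (((f (z + h) - f z) / h - L) * h)%C
      by (field; exact N).
    rewrite Cmod_mult. apply Rmult_le_compat_r; [apply Cmod_ge_0|lra].
- intros H eps He. destruct (H (eps / 2)) as [d [Hd H1]]; [lra|].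
  exists d. split; [exact Hd|]. intros h N Hh. change C in (type of h).
  change (Cmod ((f (z + h) - f z) / h - L)%C < eps).
  change (h <> 0%C) in N.
  specialize (H1 h Hh).
  replace ((f (z + h) - f z) / h - L)%C with ((f (z + h) - f z - L * h) / h)%C
    by (field; exact N).
  rewrite Cmod_div by exact N.
  assert (P : 0 < Cmod h) by (apply Cmod_gt_0, N).
  apply Rle_lt_trans with (eps / 2); [|lra].
  apply Rle_div_l; assumption.
Qed.

Definition ccont (f : C -> C) (z : C) : Prop :=
  forall eps, 0 < eps -> exists delta, 0 < delta /\
    forall h, Cmod h < delta -> Cmod (f (z + h) - f z)%C < eps.

Lemma cdiff_lip f z L : cdiff f z L ->
  exists delta, 0 < delta /\ forall h, Cmod h < delta ->
    Cmod (f (z + h) - f z)%C <= (Cmod L + 1) * Cmod h.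
Proof.
intros H. destruct (H 1) as [d [Hd H1]]; [lra|].
exists d. split; [exact Hd|]. intros h Hh. specialize (H1 h Hh).
replace (f (z + h) - f z)%C with ((f (z + h) - f z - L * h) + L * h)%C by ring.
eapply Rle_trans; [apply Cmod_triangle|]. rewrite Cmod_mult. lra.
Qed.

Lemma cdiff_ccont f z L : cdiff f z L -> ccont f z.
Proof.
intros H eps He. destruct (cdiff_lip f z L H) as [d [Hd H1]].
pose proof (Cmod_ge_0 L) as PL.
exists (Rmin d (eps / (Cmod L + 1))). split.
- apply Rmin_pos; [exact Hd|]. apply Rdiv_lt_0_compat; lra.
- intros h Hh.
  assert (K1 := Rmin_l d (eps / (Cmod L + 1))). assert (K2 := Rmin_r d (eps / (Cmod L + 1))).
  eapply Rle_lt_trans; [apply H1; lra|].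
  rewrite Rmult_comm. apply Rlt_div_r; lra.
Qed.

Lemma cdiff_ext_loc f g z L r : 0 < r ->
  (forall h, Cmod h < r -> f (z + h)%C = g (z + h)%C) -> cdiff f z L -> cdiff g z L.
Proof.
intros Hr E H eps He. destruct (H eps He) as [d [Hd H1]].
exists (Rmin d r). split; [apply Rmin_pos; assumption|]. intros h Hh.
assert (K1 := Rmin_l d r). assert (K2 := Rmin_r d r).
rewrite <- E by lra.
assert (E0 : f z = g z).
{ specialize (E 0%C). rewrite Cmod_0, Cplus_0_r in E. apply E, Hr. }
rewrite <- E0. apply H1. lra.
Qed.

Lemma cdiff_const c z : cdiff (fun _ => c) z 0%C.
Proof.
intros eps He. exists 1. split; [lra|]. intros h _.
replace (c - c - 0 * h)%C with (RtoC 0) by ring.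
rewrite Cmod_0. apply Rmult_le_pos; [lra|apply Cmod_ge_0].
Qed.

Lemma cdiff_id z : cdiff (fun z => z) z 1%C.
Proof.
intros eps He. exists 1. split; [lra|]. intros h _.
replace (z + h - z - 1 * h)%C with (RtoC 0) by ring.
rewrite Cmod_0. apply Rmult_le_pos; [lra|apply Cmod_ge_0].
Qed.

Lemma cdiff_plus f g z L M : cdiff f z L -> cdiff g z M ->
  cdiff (fun z => f z + g z)%C z (L + M)%C.
Proof.
intros Hf Hg eps He.
destruct (Hf (eps / 2)) as [d1 [Hd1 H1]]; [lra|].
destruct (Hg (eps / 2)) as [d2 [Hd2 H2]]; [lra|].
exists (Rmin d1 d2). split; [apply Rmin_pos; assumption|]. intros h Hh.
assert (K1 := Rmin_l d1 d2). assert (K2 := Rmin_r d1 d2).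
specialize (H1 h ltac:(lra)). specialize (H2 h ltac:(lra)).
replace (f (z + h) + g (z + h) - (f z + g z) - (L + M) * h)%C with
  ((f (z + h) - f z - L * h) + (g (z + h) - g z - M * h))%C by ring.
eapply Rle_trans; [apply Cmod_triangle|]. lra.
Qed.

Lemma cdiff_mult f g z L M : cdiff f z L -> cdiff g z M ->
  cdiff (fun z => f z * g z)%C z (L * g z + f z * M)%C.
Proof.
intros Hf Hg eps He.
set (K := Cmod (g z) + Cmod (f z) + Cmod L + 1).
assert (HK : 0 < K).
{ unfold K. pose proof (Cmod_ge_0 (g z)). pose proof (Cmod_ge_0 (f z)).
  pose proof (Cmod_ge_0 L). lra. }
set (e := eps / (3 * K)).
assert (He' : 0 < e) by (apply Rdiv_lt_0_compat; lra).
destruct (Hf e He') as [d1 [Hd1 H1]].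
destruct (Hg e He') as [d2 [Hd2 H2]].
destruct (cdiff_lip f z L Hf) as [d3 [Hd3 H3]].
destruct (cdiff_ccont g z M Hg e He') as [d4 [Hd4 H4]].
exists (Rmin (Rmin d1 d2) (Rmin d3 d4)).
split; [repeat apply Rmin_pos; assumption|]. intros h Hh.
assert (K1 := Rmin_l d1 d2). assert (K2 := Rmin_r d1 d2).
assert (K3 := Rmin_l d3 d4). assert (K4 := Rmin_r d3 d4).
assert (K5 := Rmin_l (Rmin d1 d2) (Rmin d3 d4)).
assert (K6 := Rmin_r (Rmin d1 d2) (Rmin d3 d4)).
specialize (H1 h ltac:(lra)). specialize (H2 h ltac:(lra)).
specialize (H3 h ltac:(lra)). specialize (H4 h ltac:(lra)).
replace (f (z + h) * g (z + h) - f z * g z - (L * g z + f z * M) * h)%C with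
  ((f (z + h) - f z) * (g (z + h) - g z) + (f (z + h) - f z - L * h) * g z
   + f z * (g (z + h) - g z - M * h))%C by ring.
eapply Rle_trans; [apply Cmod_triangle|].
eapply Rle_trans; [apply Rplus_le_compat_r, Cmod_triangle|].
rewrite !Cmod_mult.
pose proof (Cmod_ge_0 h) as Ph.
pose proof (Cmod_ge_0 (g z)) as Pg. pose proof (Cmod_ge_0 (f z)) as Pf.
pose proof (Cmod_ge_0 L) as PL.
assert (B1 : Cmod (f (z + h) - f z)%C * Cmod (g (z + h) - g z)%C <= K * Cmod h * e).
{ apply Rmult_le_compat; try apply Cmod_ge_0; [|lra].
  eapply Rle_trans; [exact H3|]. apply Rmult_le_compat_r; [exact Ph|]. unfold K; lra. }
assert (B2 : Cmod (f (z + h) - f z - L * h)%C * Cmod (g z) <= e * Cmod h * K).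
{ apply Rmult_le_compat; try apply Cmod_ge_0; [exact H1|]. unfold K; lra. }
assert (B3 : Cmod (f z) * Cmod (g (z + h) - g z - M * h)%C <= K * (e * Cmod h)).
{ apply Rmult_le_compat; try apply Cmod_ge_0; [|exact H2]. unfold K; lra. }
replace (eps * Cmod h) with (K * Cmod h * e + e * Cmod h * K + K * (e * Cmod h))
  by (unfold e; field; lra).
lra.
Qed.

Lemma cdiff_comp f g z L M : cdiff f (g z) L -> cdiff g z M ->
  cdiff (fun z => f (g z)) z (L * M)%C.
Proof.
intros Hf Hg eps He.
set (K := Cmod L + Cmod M + 1).
pose proof (Cmod_ge_0 L) as PL. pose proof (Cmod_ge_0 M) as PM.
assert (HK : 0 < K) by (unfold K; lra).
set (e := eps / (2 * K)).
assert (He' : 0 < e) by (apply Rdiv_lt_0_compat; lra).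
destruct (Hf e He') as [d1 [Hd1 H1]].
destruct (Hg e He') as [d2 [Hd2 H2]].
destruct (cdiff_lip g z M Hg) as [d3 [Hd3 H3]].
destruct (cdiff_ccont g z M Hg d1 Hd1) as [d4 [Hd4 H4]].
exists (Rmin d2 (Rmin d3 d4)).
split; [repeat apply Rmin_pos; assumption|]. intros h Hh.
assert (K3 := Rmin_l d3 d4). assert (K4 := Rmin_r d3 d4).
assert (K5 := Rmin_l d2 (Rmin d3 d4)). assert (K6 := Rmin_r d2 (Rmin d3 d4)).
specialize (H2 h ltac:(lra)). specialize (H3 h ltac:(lra)). specialize (H4 h ltac:(lra)).
specialize (H1 _ H4).
replace (g z + (g (z + h) - g z))%C with (g (z + h))%C in H1 by ring.
replace (f (g (z + h)) - f (g z) - L * M * h)%C with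
  ((f (g (z + h)) - f (g z) - L * (g (z + h) - g z)) + L * (g (z + h) - g z - M * h))%C
  by ring.
eapply Rle_trans; [apply Cmod_triangle|]. rewrite Cmod_mult.
pose proof (Cmod_ge_0 h) as Ph.
assert (B1 : e * Cmod (g (z + h) - g z)%C <= e * (K * Cmod h)).
{ apply Rmult_le_compat_l; [lra|]. eapply Rle_trans; [exact H3|].
  apply Rmult_le_compat_r; [exact Ph|]. unfold K; lra. }
assert (B2 : Cmod L * Cmod (g (z + h) - g z - M * h)%C <= K * (e * Cmod h)).
{ apply Rmult_le_compat; try apply Cmod_ge_0; [|exact H2]. unfold K; lra. }
replace (eps * Cmod h) with (e * (K * Cmod h) + K * (e * Cmod h)) by (unfold e; field; lra).
lra.
Qed.

(** The inverse, the exponential and the square root all get their derivatives from an explicit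
    second-order remainder. *)
Lemma cdiff_quadratic f z L K r : 0 < r -> 0 <= K ->
  (forall h, Cmod h < r -> Cmod (f (z + h) - f z - L * h)%C <= K * Cmod h ^ 2) ->
  cdiff f z L.
Proof.
intros Hr HK H eps He. exists (Rmin r (eps / (K + 1))). split.
- apply Rmin_pos; [exact Hr|]. apply Rdiv_lt_0_compat; lra.
- intros h Hh.
  assert (K1 := Rmin_l r (eps / (K + 1))). assert (K2 := Rmin_r r (eps / (K + 1))).
  eapply Rle_trans; [apply H; lra|].
  pose proof (Cmod_ge_0 h) as Ph.
  assert (Cmod h * (K + 1) <= eps).
  { apply Rle_div_r; lra. }
  nra.
Qed.

(** * Derivatives of the inverse and of the exponential *)

Lemma cdiff_inv (z : C) : z <> 0%C -> cdiff Cinv z (- / (z * z))%C.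
Proof.
intros N. assert (P : 0 < Cmod z) by (apply Cmod_gt_0, N).
(* The remainder is exactly h^2 / (z^2 (z + h)), and |z + h| >= |z|/2 for |h| < |z|/2. *)
apply cdiff_quadratic with (K := 2 / Cmod z ^ 3) (r := Cmod z / 2).
- lra.
- apply Rlt_le, Rdiv_lt_0_compat; [lra|apply pow_lt, P].
- intros h Hh.
  assert (B : Cmod z / 2 <= Cmod (z + h)).
  { assert (T := Cmod_triangle (z + h) (- h)). rewrite Cmod_opp in T.
    replace (z + h + - h)%C with z in T by ring. lra. }
  assert (N2 : (z + h)%C <> 0%C) by (apply Cmod_gt_0; lra).
  replace (/ (z + h) - / z - - / (z * z) * h)%C with (h * h / (z * z * (z + h)))%C
    by (field; split; assumption).
  rewrite Cmod_div by (repeat apply Cmult_neq_0; assumption).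
  rewrite !Cmod_mult.
  apply Rle_div_l.
  { repeat apply Rmult_lt_0_compat; lra. }
  replace (Cmod h * Cmod h) with
    (2 / Cmod z ^ 3 * Cmod h ^ 2 * (Cmod z * Cmod z * (Cmod z / 2))) by (field; lra).
  apply Rmult_le_compat_l.
  + apply Rmult_le_pos; [|apply pow2_ge_0].
    apply Rlt_le, Rdiv_lt_0_compat; [lra|apply pow_lt, P].
  + apply Rmult_le_compat_l; [nra|exact B].
Qed.

(** One use of the mean value theorem raises the exponent by one at the same constant. Iterated, it
    gives Taylor estimates without factorials, which is sharp enough here. *)
Lemma power_bound_of_deriv (f df : R -> R) (K : R) (n : nat) :
  f 0 = 0 -> (forall t, is_derive f t (df t)) ->
  (forall t, Rabs t <= 1 -> Rabs (df t) <= K * Rabs t ^ n) ->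
  0 <= K ->
  forall x, Rabs x <= 1 -> Rabs (f x) <= K * Rabs x ^ S n.
Proof.
intros H0 Hd HK PK x Hx.
destruct (MVT_gen f 0 x df) as [c [Hc E]].
- intros t _. apply Hd.
- intros t _. apply continuity_pt_filterlim, (ex_derive_continuous (V := R_NormedModule)).
  eexists; apply Hd.
- assert (A : Rabs c <= Rabs x).
  { unfold Rmin, Rmax in Hc. destruct (Rle_dec 0 x).
    - rewrite !Rabs_pos_eq; lra.
    - rewrite !Rabs_left1; lra. }
  rewrite H0, !Rminus_0_r in E. rewrite E, Rabs_mult. simpl.
  rewrite (Rmult_comm (Rabs x)), <- Rmult_assoc.
  apply Rmult_le_compat_r; [apply Rabs_pos|].
  eapply Rle_trans; [apply HK; lra|]. apply Rmult_le_compat_l; [exact PK|].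
  apply pow_incr. split; [apply Rabs_pos|exact A].
Qed.

Lemma exp_taylor2 x : Rabs x <= 1 -> Rabs (exp x - 1 - x - x ^ 2 / 2) <= 3 * Rabs x ^ 3.
Proof.
apply (power_bound_of_deriv (fun x => exp x - 1 - x - x ^ 2 / 2) (fun x => exp x - 1 - x) 3 2).
- rewrite exp_0. field.
- intros t. auto_derive; [exact I|]. field.
- apply (power_bound_of_deriv (fun x => exp x - 1 - x) (fun x => exp x - 1) 3 1).
  + rewrite exp_0. ring.
  + intros t. auto_derive; [exact I|]. ring.
  + apply (power_bound_of_deriv (fun x => exp x - 1) (fun x => exp x) 3 0).
    * rewrite exp_0. ring.
    * intros t. auto_derive; [exact I|]. ring.
    * intros t Ht. rewrite Rabs_pos_eq by (left; apply exp_pos). simpl.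
      apply Rabs_le_between in Ht. pose proof exp_le_3.
      destruct (Req_dec t 1) as [->|N]; [lra|].
      assert (exp t < exp 1) by (apply exp_increasing; lra). lra.
    * lra.
  + lra.
- lra.
Qed.

Lemma sin_taylor x : Rabs x <= 1 -> Rabs (sin x - x) <= Rabs x ^ 3.
Proof.
intros Hx. rewrite <- (Rmult_1_l (Rabs x ^ 3)). revert x Hx.
apply (power_bound_of_deriv (fun x => sin x - x) (fun x => cos x - 1) 1 2).
- rewrite sin_0. ring.
- intros t. auto_derive; [exact I|]. ring.
- apply (power_bound_of_deriv (fun x => cos x - 1) (fun x => - sin x) 1 1).
  + rewrite cos_0. ring.
  + intros t. auto_derive; [exact I|]. ring.
  + apply (power_bound_of_deriv (fun x => - sin x) (fun x => - cos x) 1 0).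
    * rewrite sin_0. ring.
    * intros t. auto_derive; [exact I|]. ring.
    * intros t _. rewrite Rabs_Ropp. simpl. pose proof (COS_bound t).
      apply Rabs_le. lra.
    * lra.
  + lra.
- lra.
Qed.

Lemma cos_taylor x : Rabs x <= 1 -> Rabs (cos x - 1 + x ^ 2 / 2) <= Rabs x ^ 3.
Proof.
intros Hx.
assert (B : Rabs (cos x - 1 + x ^ 2 / 2) <= 1 * Rabs x ^ 4).
{ revert x Hx.
  apply (power_bound_of_deriv (fun x => cos x - 1 + x ^ 2 / 2) (fun x => - (sin x - x)) 1 3).
  - rewrite cos_0. field.
  - intros t. auto_derive; [exact I|]. field.
  - intros t Ht. rewrite Rabs_Ropp, Rmult_1_l. apply sin_taylor, Ht.
  - lra. }
simpl in *. pose proof (Rabs_pos x).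
assert (0 <= Rabs x * (Rabs x * (Rabs x * 1))) by (repeat apply Rmult_le_pos; lra).
nra.
Qed.

Lemma Cmod_le_sum (z : C) : Cmod z <= Rabs (fst z) + Rabs (snd z).
Proof.
destruct z as [x y]. unfold Cmod. simpl fst. simpl snd.
pose proof (Rabs_pos x). pose proof (Rabs_pos y).
rewrite <- (sqrt_pow2 (Rabs x + Rabs y)) by lra.
apply sqrt_le_1_alt. rewrite <- (pow2_abs x), <- (pow2_abs y). nra.
Qed.

Lemma Rabs_fst_le (z : C) : Rabs (fst z) <= Cmod z.
Proof. eapply Rle_trans; [apply Rmax_l|apply Rmax_Cmod]. Qed.

Lemma Rabs_snd_le (z : C) : Rabs (snd z) <= Cmod z.
Proof. eapply Rle_trans; [apply Rmax_r|apply Rmax_Cmod]. Qed.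

Lemma Rabs_mult_le (a b A B : R) : Rabs a <= A -> Rabs b <= B -> Rabs (a * b) <= A * B.
Proof.
intros HA HB. rewrite Rabs_mult.
apply Rmult_le_compat; try apply Rabs_pos; assumption.
Qed.

(** The order three is dictated by (e^z - 1)/z: after division by h the error must still be
    quadratic to give a derivative at the origin. The constant 20 is a crude sum over the two
    components. *)
Lemma Cexp_taylor2 (h : C) : Cmod h <= 1 ->
  Cmod (Cexp h - 1 - h - h * h / 2)%C <= 20 * Cmod h ^ 3.
Proof.
destruct h as [x y]. intros Hh.
assert (Hx := Rabs_fst_le (x, y)). assert (Hy := Rabs_snd_le (x, y)). simpl fst in Hx. simpl snd in Hy.
set (r := Cmod (x, y)) in *.
assert (Hr : 0 <= r) by apply Cmod_ge_0.
assert (A1 := exp_taylor2 x ltac:(lra)).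
assert (A2 := sin_taylor y ltac:(lra)).
assert (A3 := cos_taylor y ltac:(lra)).
set (al := exp x - 1 - x - x ^ 2 / 2) in *.
set (be := cos y - 1 + y ^ 2 / 2) in *.
set (ga := sin y - y) in *.
assert (C3 : forall t, Rabs t <= r -> Rabs t ^ 3 <= r ^ 3).
{ intros t Ht. apply pow_incr. split; [apply Rabs_pos|exact Ht]. }
assert (X3 := C3 x Hx). assert (Y3 := C3 y Hy).
assert (R3 : 0 <= r ^ 3) by (apply pow_le, Hr).
assert (Bal : Rabs al <= 3 * r ^ 3) by lra.
assert (Bbe : Rabs be <= r ^ 3) by lra.
assert (Bga : Rabs ga <= r ^ 3) by lra.
assert (Ex : Rabs (exp x) <= 3).
{ rewrite Rabs_pos_eq by (left; apply exp_pos).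
  pose proof exp_le_3. pose proof (Rle_abs x).
  destruct (Req_dec x 1) as [->|N]; [lra|].
  assert (exp x < exp 1) by (apply exp_increasing; lra). lra. }
assert (Cy : Rabs (cos y) <= 1) by (pose proof (COS_bound y); apply Rabs_le; lra).
assert (Px : Rabs (1 + x + x ^ 2 / 2) <= 3).
{ pose proof (Rabs_triang (1 + x) (x ^ 2 / 2)). pose proof (Rabs_triang 1 x).
  rewrite Rabs_R1 in *.
  assert (Rabs (x ^ 2 / 2) <= 1).
  { rewrite Rabs_pos_eq by nra. rewrite <- (pow2_abs x). pose proof (Rabs_pos x). nra. }
  lra. }
assert (Hx1 : Rabs x <= 1) by lra. assert (Hy1 : Rabs y <= 1) by lra.
assert (Bxyy : Rabs (x * (y * y)) <= r ^ 3).
{ replace (r ^ 3) with (r * (r * r)) by ring. repeat apply Rabs_mult_le; assumption. }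
assert (Bxxy : Rabs (x * (x * y)) <= r ^ 3).
{ replace (r ^ 3) with (r * (r * r)) by ring. repeat apply Rabs_mult_le; assumption. }
assert (Bxxyy : Rabs (x * (x * (y * y))) <= r ^ 3).
{ replace (r ^ 3) with (1 * (r * (r * r))) by ring. repeat apply Rabs_mult_le; assumption. }
eapply Rle_trans; [apply Cmod_le_sum|].
(* After expanding e^x, cos y and sin y, all terms of degree at most two cancel; each survivor has
   degree at least three or contains one of the remainders [al], [be], [ga]. *)
assert (E1 : fst (Cexp (x, y) - 1 - (x, y) - (x, y) * (x, y) / 2)%C =
   - (x * (y * y)) / 2 - x * (x * (y * y)) / 4 + al * cos y + (1 + x + x ^ 2 / 2) * be).
{ unfold al, be. simpl. field. }
assert (E2 : snd (Cexp (x, y) - 1 - (x, y) - (x, y) * (x, y) / 2)%C =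
   x * (x * y) / 2 + al * y + exp x * ga).
{ unfold al, ga. simpl. field. }
rewrite E1, E2.
assert (D1 := Rabs_mult_le _ _ _ _ Bal Cy). assert (D2 := Rabs_mult_le _ _ _ _ Px Bbe).
assert (D3 := Rabs_mult_le _ _ _ _ Bal Hy1). assert (D4 := Rabs_mult_le _ _ _ _ Ex Bga).
apply Rabs_le_between in D1. apply Rabs_le_between in D2.
apply Rabs_le_between in D3. apply Rabs_le_between in D4.
apply Rabs_le_between in Bxyy. apply Rabs_le_between in Bxxy. apply Rabs_le_between in Bxxyy.
assert (F1 : Rabs (- (x * (y * y)) / 2 - x * (x * (y * y)) / 4 + al * cos y + (1 + x + x ^ 2 / 2) * be) <= 10 * r ^ 3)
  by (apply Rabs_le; lra).
assert (F2 : Rabs (x * (x * y) / 2 + al * y + exp x * ga) <= 10 * r ^ 3)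
  by (apply Rabs_le; lra).
lra.
Qed.

Lemma Cexp_plus (z w : C) : Cexp (z + w)%C = (Cexp z * Cexp w)%C.
Proof.
destruct z as [a b], w as [c d]. unfold Cexp; simpl.
unfold Cmult; simpl. rewrite exp_plus, cos_plus, sin_plus.
f_equal; ring.
Qed.

Lemma Cexp_mod (z : C) : Cmod (Cexp z) = exp (fst z).
Proof.
destruct z as [a b]. unfold Cexp, Cmod; simpl fst; simpl snd.
transitivity (sqrt (exp a ^ 2)); [|apply sqrt_pow2; left; apply exp_pos].
f_equal. pose proof (sin2_cos2 b) as H. unfold Rsqr in H.
replace ((exp a * cos b) ^ 2 + (exp a * sin b) ^ 2) with
  (exp a ^ 2 * (sin b * sin b + cos b * cos b)) by ring.
rewrite H. ring.
Qed.

Lemma Cexp_0 : Cexp (RtoC 0) = RtoC 1.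
Proof. unfold Cexp; simpl. rewrite exp_0, cos_0, sin_0. apply injective_projections; simpl; ring. Qed.

Lemma Cexp_neq_0 (z : C) : Cexp z <> RtoC 0.
Proof. apply Cmod_gt_0. rewrite Cexp_mod. apply exp_pos. Qed.

Lemma cdiff_exp (z : C) : cdiff Cexp z (Cexp z).
Proof.
apply cdiff_quadratic with (K := Cmod (Cexp z) * 21) (r := 1).
- lra.
- apply Rmult_le_pos; [apply Cmod_ge_0|lra].
- intros h Hh. rewrite Cexp_plus.
  replace (Cexp z * Cexp h - Cexp z - Cexp z * h)%C with
    (Cexp z * ((Cexp h - 1 - h - h * h / 2) + h * h / 2))%C by field.
  rewrite Cmod_mult, Rmult_assoc. apply Rmult_le_compat_l; [apply Cmod_ge_0|].
  eapply Rle_trans; [apply Cmod_triangle|].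
  assert (A := Cexp_taylor2 h ltac:(lra)).
  assert (B : Cmod (h * h / 2)%C <= Cmod h ^ 2).
  { rewrite Cmod_div, !Cmod_mult, Cmod_R, Rabs_pos_eq by (try lra; apply RtoC_neq_0; lra).
    pose proof (Cmod_ge_0 h). nra. }
  pose proof (Cmod_ge_0 h).
  assert (0 <= Cmod h ^ 2) by apply pow2_ge_0.
  assert (Cmod h ^ 3 <= Cmod h ^ 2) by (simpl in *; nra).
  lra.
Qed.

(** For the exponential class, the quotient (phi z - 1)/z whose primitive is taken must be
    differentiable at its removable singularity too. The test on [Cmod z] makes z = 0 decidable
    through equality of reals. *)
Lemma cdiff_expm1_div :
  cdiff (fun z => if Req_EM_T (Cmod z) 0 then 1%C else ((Cexp z - 1) / z)%C) 0%C (/ 2)%C.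
Proof.
apply cdiff_quadratic with (K := 20) (r := 1); [lra|lra|].
intros h Hh. rewrite Cplus_0_l, Cmod_0.
destruct (Req_EM_T 0 0) as [_|n]; [|lra].
destruct (Req_EM_T (Cmod h) 0) as [E|N].
- apply Cmod_eq_0 in E. subst h.
  replace (1 - 1 - / 2 * 0)%C with (RtoC 0) by ring. rewrite Cmod_0. lra.
- assert (Nh : h <> 0%C) by (intros ->; rewrite Cmod_0 in N; lra).
  assert (P : 0 < Cmod h) by (apply Cmod_gt_0, Nh).
  replace ((Cexp h - 1) / h - 1 - / 2 * h)%C with ((Cexp h - 1 - h - h * h / 2) / h)%C
    by (field; exact Nh).
  rewrite Cmod_div by exact Nh. apply Rle_div_l; [exact P|].
  eapply Rle_trans; [apply Cexp_taylor2; lra|]. apply Req_le. ring.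
Qed.

(** * The Schwarz lemma *)

Lemma Cmod_le_2Rmax (z : C) : Cmod z <= 2 * Rmax (Rabs (fst z)) (Rabs (snd z)).
Proof.
eapply Rle_trans; [apply Cmod_le_sum|].
assert (A := Rmax_l (Rabs (fst z)) (Rabs (snd z))).
assert (B := Rmax_r (Rabs (fst z)) (Rabs (snd z))). lra.
Qed.

Lemma cdiff_locally_2d (f : C -> C) (x y : R) (L : C) :
  cdiff f (x, y) L ->
  forall eps : posreal, locally_2d (fun u v =>
    Cmod (f (u, v) - f (x, y) - L * (u - x, v - y)%R)%C
      <= eps * Rmax (Rabs (u - x)) (Rabs (v - y))) x y.
Proof.
intros H eps. destruct (H (eps / 2)) as [d [Hd H1]].
{ pose proof (cond_pos eps). lra. }
assert (Hd2 : 0 < d / 2) by lra.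
exists (mkposreal (d / 2) Hd2). simpl. intros u v Hu Hv.
set (h := (u - x, v - y) : C).
assert (B : Cmod h <= 2 * Rmax (Rabs (u - x)) (Rabs (v - y))) by apply (Cmod_le_2Rmax h).
assert (Hm : Rmax (Rabs (u - x)) (Rabs (v - y)) < d / 2) by (apply Rmax_lub_lt; assumption).
specialize (H1 h ltac:(lra)).
replace ((x, y) + h)%C with ((u, v) : C) in H1
  by (apply injective_projections; simpl; ring).
eapply Rle_trans; [exact H1|].
pose proof (cond_pos eps). nra.
Qed.

(** Multiplication by [L] is the real matrix with rows (Re L, -Im L) and (Im L, Re L); the rows are
    the gradients of Re f here and of Im f in the next lemma. *)
Lemma cdiff_fst (f : C -> C) (x y : R) (L : C) : cdiff f (x, y) L ->
  differentiable_pt_lim (fun u v => fst (f (u, v))) x y (fst L) (- snd L).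
Proof.
intros H eps. destruct (cdiff_locally_2d f x y L H eps) as [d Hd].
exists d. intros u v Hu Hv. eapply Rle_trans; [|apply (Hd u v Hu Hv)].
eapply Rle_trans; [|apply Rabs_fst_le]. apply Req_le. f_equal. simpl. ring.
Qed.

Lemma cdiff_snd (f : C -> C) (x y : R) (L : C) : cdiff f (x, y) L ->
  differentiable_pt_lim (fun u v => snd (f (u, v))) x y (snd L) (fst L).
Proof.
intros H eps. destruct (cdiff_locally_2d f x y L H eps) as [d Hd].
exists d. intros u v Hu Hv. eapply Rle_trans; [|apply (Hd u v Hu Hv)].
eapply Rle_trans; [|apply Rabs_snd_le]. apply Req_le. f_equal. simpl. ring.
Qed.

(* [Im (f dz) = Im f dx + Re f dy] is closed by the Cauchy-Riemann equations. *)
Lemma cdiff_closed_im (f : C -> C) (x y : R) (L : C) : cdiff f (x, y) L ->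
  closed_at (fun u v => snd (f (u, v))) (fun u v => fst (f (u, v))) x y.
Proof.
intros H. exists (snd L), (fst L), (- snd L).
split; [apply cdiff_snd, H|apply cdiff_fst, H].
Qed.

(** The form is Re (f dz) = Re f dx - Im f dy; the shared mixed partial is -Im L. *)
Lemma cdiff_closed_re (f : C -> C) (x y : R) (L : C) : cdiff f (x, y) L ->
  closed_at (fun u v => fst (f (u, v))) (fun u v => - snd (f (u, v))) x y.
Proof.
intros H. exists (fst L), (- snd L), (- fst L).
split; [apply cdiff_fst, H|].
intros eps. destruct (cdiff_snd f x y L H eps) as [d Hd].
exists d. intros u v Hu Hv. eapply Rle_trans; [|apply (Hd u v Hu Hv)].
apply Req_le. rewrite <- Rabs_Ropp. f_equal. ring.
Qed.

(** * Maxima on closed discs and the maximum principle *)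

Lemma Cplus_sub_cancel (z w : C) : (z + (w - z))%C = w.
Proof. ring. Qed.

Lemma Cmod_le_add (z h : C) : Cmod z <= Cmod (z + h) + Cmod h.
Proof.
rewrite <- (Cmod_opp h). replace z with (z + h + - h)%C at 1 by ring.
apply Cmod_triangle.
Qed.

(** Bisection takes the place of compactness: a rectangle is kept when each value of [F] on the disc
    is matched or exceeded at some disc point inside the rectangle. By continuity the limit point
    then dominates everything. *)
Lemma disc_max (F : C -> R) (r : R) : 0 <= r ->
  (forall z, Cmod z <= r -> forall eps, 0 < eps -> exists delta, 0 < delta /\
     forall h, Cmod h < delta -> Rabs (F (z + h)%C - F z) < eps) ->
  exists z0, Cmod z0 <= r /\ forall z, Cmod z <= r -> F z <= F z0.
Proof.
intros Hr HF.
pose (Bad := fun a b c d => forall p, Cmod p <= r -> exists q, Cmod q <= r /\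
  a <= fst q <= b /\ c <= snd q <= d /\ F p <= F q).
destruct (bisection Bad (- r) r (- r) r) as (x & y & Hx & Hy & Hk); try lra.
- intros p Hp. exists p.
  assert (A1 := Rabs_fst_le p). assert (A2 := Rabs_snd_le p).
  assert (A3 : Rabs (fst p) <= r) by lra. assert (A4 : Rabs (snd p) <= r) by lra.
  apply Rabs_le_between in A3. apply Rabs_le_between in A4. repeat split; lra.
- intros a b c d Hab Hcd HB. apply NNPP. intros N.
  apply not_or_and in N. destruct N as [N1 N].
  apply not_or_and in N. destruct N as [N2 N].
  apply not_or_and in N. destruct N as [N3 N4].
  assert (X : forall a b c d, ~ Bad a b c d -> exists p, Cmod p <= r /\
    forall q, Cmod q <= r -> a <= fst q <= b -> c <= snd q <= d -> F q < F p).
  { clear. intros a b c d H. apply not_all_ex_not in H. destruct H as [p H].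
    apply imply_to_and in H. destruct H as [Hp H]. exists p. split; [exact Hp|].
    intros q Hq H1 H2. apply Rnot_le_lt. intros H3. apply H. exists q. auto. }
  destruct (X _ _ _ _ N1) as [p1 [P1 Q1]]. destruct (X _ _ _ _ N2) as [p2 [P2 Q2]].
  destruct (X _ _ _ _ N3) as [p3 [P3 Q3]]. destruct (X _ _ _ _ N4) as [p4 [P4 Q4]].
  (* If all four quarters failed, each would have a disc point beating all its values; the best of
     the four beats the whole rectangle, which was supposed to be kept. *)
  assert (M : exists p, Cmod p <= r /\ F p1 <= F p /\ F p2 <= F p /\ F p3 <= F p /\ F p4 <= F p).
  { assert (Mx : forall p q, Cmod p <= r -> Cmod q <= r ->
      exists s, Cmod s <= r /\ F p <= F s /\ F q <= F s).
    { intros p q Hp Hq. destruct (Rle_dec (F p) (F q)); [exists q|exists p]; repeat split; lra. }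
    destruct (Mx p1 p2 P1 P2) as (s & S1 & S2 & S3).
    destruct (Mx p3 p4 P3 P4) as (t & T1 & T2 & T3).
    destruct (Mx s t S1 T1) as (u & U1 & U2 & U3).
    exists u. repeat split; lra. }
  destruct M as (p & Hp & M1 & M2 & M3 & M4).
  destruct (HB p Hp) as (q & Hq & B1 & B2 & B3).
  destruct (Rle_dec (fst q) ((a + b) / 2)); destruct (Rle_dec (snd q) ((c + d) / 2)).
  + specialize (Q1 q Hq ltac:(lra) ltac:(lra)). lra.
  + specialize (Q3 q Hq ltac:(lra) ltac:(lra)). lra.
  + specialize (Q2 q Hq ltac:(lra) ltac:(lra)). lra.
  + specialize (Q4 q Hq ltac:(lra) ltac:(lra)). lra.
- assert (Near : forall eps, 0 < eps -> forall p, Cmod p <= r ->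
    exists h, Cmod h < eps /\ Cmod ((x, y) + h)%C <= r /\ F p <= F ((x, y) + h)%C).
  { intros eps He p Hp. destruct (pow_half_small (r - - r) (eps / 2)) as [k Hkk]; [lra|].
    destruct (Hk k) as (a & b & c & d & H1 & H2 & H3 & H4 & HB).
    destruct (HB p Hp) as (q & Hq & Q1 & Q2 & Q3).
    exists (q - (x, y))%C.
    rewrite Cplus_sub_cancel.
    split; [|split; assumption].
    eapply Rle_lt_trans; [apply Cmod_le_2Rmax|]. simpl.
    assert (Rmax (Rabs (fst q + - x)) (Rabs (snd q + - y)) <= (r - - r) / 2 ^ k).
    { apply Rmax_lub; apply Rabs_le; lra. }
    lra. }
  (* The rectangles may stick out of the disc, so membership of the limit point is derived from the
     disc points that come arbitrarily near it. *)
  assert (HD : Cmod (x, y) <= r).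
  { apply Rnot_lt_le. intros N.
    destruct (Near (Cmod (x, y) - r) ltac:(lra) 0%C) as (h & Hh & H1 & _).
    { rewrite Cmod_0. exact Hr. }
    assert (T := Cmod_le_add (x, y) h). lra. }
  exists (x, y). split; [exact HD|]. intros p Hp.
  apply Rnot_lt_le. intros N.
  destruct (HF (x, y) HD (F p - F (x, y)) ltac:(lra)) as (dl & Hdl & H1).
  destruct (Near dl Hdl p Hp) as (h & Hh & H2 & H3).
  specialize (H1 h Hh). apply Rabs_lt_between in H1. lra.
Qed.

(* Circles around [z0] are the images of vertical segments under [z0 + exp], so that
   the mean value property becomes Goursat's theorem on a rectangle of height [2 PI]. *)
Lemma no_strict_max_on_circle (H : C -> C) (z0 : C) (rho eta : R) :
  0 < rho -> 0 < eta ->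
  (forall z, 0 < Cmod (z - z0)%C <= rho -> exists L, cdiff H z L) ->
  ccont H z0 ->
  (forall z, Cmod (z - z0)%C = rho -> fst (H z) <= fst (H z0) - eta) ->
  False.
Proof.
intros Hrho Heta Hd Hc Hb.
destruct (Hc (eta / 2) ltac:(lra)) as (dl & Hdl & Hc1).
(* The abscissa [s2] corresponds to the circle of radius [rho], and [s1] to one of radius less than
   [dl], on which [H] differs from H(z0) by less than eta/2. *)
set (s2 := ln rho). set (s1 := Rmin s2 (ln dl) - 1).
assert (S1 := Rmin_l s2 (ln dl)). assert (S2 := Rmin_r s2 (ln dl)).
assert (E2 : exp s2 = rho) by (apply exp_ln, Hrho).
assert (E1 : exp s1 < dl).
{ rewrite <- (exp_ln dl Hdl). apply exp_increasing. unfold s1. lra. }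
pose (G := fun z : C => H (z0 + Cexp z)%C).
assert (HG : forall x y, x <= s2 -> exists L, cdiff G (x, y) L).
{ intros x y Hx. destruct (Hd (z0 + Cexp (x, y))%C) as [L HL].
  - rewrite Cplus_sub_cancel_l, Cexp_mod. simpl. split; [apply exp_pos|]. rewrite <- E2.
    destruct Hx as [Hx| ->]; [left; apply exp_increasing, Hx|lra].
  - eexists. apply (cdiff_comp H (fun z => z0 + Cexp z)%C); [exact HL|].
    apply cdiff_plus; [apply cdiff_const|apply cdiff_exp]. }
assert (Hcl : forall x y, x <= s2 ->
  closed_at (fun u v => snd (G (u, v))) (fun u v => fst (G (u, v))) x y).
{ intros x y Hx. destruct (HG x y Hx) as [L HL]. exact (cdiff_closed_im G x y L HL). }
assert (Hpi := PI_RGT_0).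
assert (S12 : s1 <= s2) by (unfold s1; lra).
assert (Z := goursat (fun u v => snd (G (u, v))) (fun u v => fst (G (u, v))) s1 s2 0 (2 * PI)
  S12 ltac:(lra)).
specialize (Z ltac:(intros x y Hx Hy; apply Hcl; lra)).
unfold loop_integral in Z.
(* The period 2 PI i of the exponential makes the horizontal sides cancel, so the integrals over the
   two vertical sides are equal. *)
rewrite (RInt_ext (fun t => snd (G (t, 0))) (fun t => snd (G (t, 2 * PI)))) in Z.
2: { intros t _. unfold G, Cexp. simpl. rewrite cos_0, sin_0, cos_2PI, sin_2PI. reflexivity. }
assert (X : forall x, x <= s2 -> ex_RInt (fun v => fst (G (x, v))) 0 (2 * PI)).
{ intros x Hx. apply (ex_RInt_slice_y (fun u v => fst (G (u, v)))); [lra|].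
  intros t _. apply (closed_at_cont2 _ _ x t (Hcl x t Hx)). }
(* The mean of Re H is at most Re H(z0) - eta on the large circle and at least Re H(z0) - eta/2 on
   the small one, although both means agree. *)
assert (U : RInt (fun v => fst (G (s2, v))) 0 (2 * PI) <= 2 * PI * (fst (H z0) - eta)).
{ replace (2 * PI * (fst (H z0) - eta)) with (RInt (fun _ => fst (H z0) - eta) 0 (2 * PI)).
  - apply RInt_le; [lra|apply X; lra|apply ex_RInt_const|].
    intros v _. apply Hb. rewrite Cplus_sub_cancel_l, Cexp_mod. exact E2.
  - rewrite RInt_const. unfold scal; simpl. unfold mult; simpl. ring. }
assert (V : 2 * PI * (fst (H z0) - eta / 2) <= RInt (fun v => fst (G (s1, v))) 0 (2 * PI)).
{ replace (2 * PI * (fst (H z0) - eta / 2)) with (RInt (fun _ => fst (H z0) - eta / 2) 0 (2 * PI)).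
  - apply RInt_le; [lra|apply ex_RInt_const|apply X; lra|].
    intros v _. specialize (Hc1 (Cexp (s1, v))). rewrite Cexp_mod in Hc1.
    specialize (Hc1 E1).
    assert (T := Rabs_fst_le (H (z0 + Cexp (s1, v)) - H z0)%C). simpl in T.
    assert (T2 : Rabs (fst (H (z0 + Cexp (s1, v))%C) + - fst (H z0)) < eta / 2) by lra.
    apply Rabs_lt_between in T2. unfold G. lra.
  - rewrite RInt_const. unfold scal; simpl. unfold mult; simpl. ring. }
nra.
Qed.

Lemma Cmod_sqr (z : C) : Cmod z ^ 2 = fst z ^ 2 + snd z ^ 2.
Proof. unfold Cmod. apply pow2_sqrt. nra. Qed.

Lemma ccont_Cmod_sqr (g : C -> C) (z : C) : ccont g z ->
  forall eps, 0 < eps -> exists delta, 0 < delta /\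
    forall h, Cmod h < delta -> Rabs (Cmod (g (z + h)%C) ^ 2 - Cmod (g z) ^ 2) < eps.
Proof.
intros Hg eps He. set (K := 2 * Cmod (g z) + 1).
assert (HK : 0 < K) by (unfold K; pose proof (Cmod_ge_0 (g z)); lra).
destruct (Hg (Rmin 1 (eps / K))) as (d & Hd & H).
{ apply Rmin_pos; [lra|]. apply Rdiv_lt_0_compat; lra. }
exists d. split; [exact Hd|]. intros h Hh. specialize (H h Hh).
assert (M1 := Rmin_l 1 (eps / K)). assert (M2 := Rmin_r 1 (eps / K)).
set (a := Cmod (g (z + h)%C)). set (b := Cmod (g z)) in *.
set (t := Cmod (g (z + h) - g z)%C) in *.
assert (T1 : a <= t + b).
{ unfold a, t, b. replace (g (z + h)%C) with (g (z + h) - g z + g z)%C at 1 by ring.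
  apply Cmod_triangle. }
assert (T2 : b <= t + a).
{ unfold a, t, b. replace (g z) with (- (g (z + h) - g z) + g (z + h))%C at 1 by ring.
  eapply Rle_trans; [apply Cmod_triangle|]. rewrite Cmod_opp. lra. }
assert (Pa : 0 <= a) by apply Cmod_ge_0. assert (Pb : 0 <= b) by apply Cmod_ge_0.
assert (Pt : 0 <= t) by apply Cmod_ge_0.
replace (a ^ 2 - b ^ 2) with ((a - b) * (a + b)) by ring.
rewrite Rabs_mult, (Rabs_pos_eq (a + b)) by lra.
assert (A : Rabs (a - b) <= t) by (apply Rabs_le; lra).
assert (B : a + b <= K) by (unfold K; lra).
apply Rle_lt_trans with (t * K).
- apply Rmult_le_compat; try lra. apply Rabs_pos.
- apply Rlt_div_r; lra.
Qed.

(* A removable singularity at the origin is allowed.  The term [eps |z|^2] makes the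
   maximum of [|g|^2] strict on small circles. *)
Lemma max_modulus (g : C -> C) (r M : R) : 0 < r < 1 -> 0 <= M ->
  (forall z, 0 < Cmod z < 1 -> exists L, cdiff g z L) -> ccont g 0%C ->
  (forall z, Cmod z = r -> Cmod (g z) <= M) ->
  forall eps z, 0 < eps -> Cmod z <= r -> Cmod (g z) ^ 2 <= M ^ 2 + eps.
Proof.
intros Hr HM Hg Hg0 Hb eps z He Hz.
assert (Hcont : forall z, Cmod z <= r -> ccont g z).
{ intros u Hu. destruct (classic (u = 0%C)) as [->|N]; [exact Hg0|].
  apply Cmod_gt_0 in N. destruct (Hg u ltac:(lra)) as [L HL]. apply (cdiff_ccont g u L HL). }
pose (F := fun z : C => Cmod (g z) ^ 2 + eps * Cmod z ^ 2).
destruct (disc_max F r ltac:(lra)) as (z0 & Hz0 & Hmax).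
{ intros u Hu e Hepos.
  destruct (ccont_Cmod_sqr g u (Hcont u Hu) (e / 2) ltac:(lra)) as (d1 & Hd1 & H1).
  destruct (ccont_Cmod_sqr (fun z => z) u (cdiff_ccont _ _ _ (cdiff_id u)) (e / (2 * eps)))
    as (d2 & Hd2 & H2).
  { apply Rdiv_lt_0_compat; lra. }
  exists (Rmin d1 d2). split; [apply Rmin_pos; assumption|]. intros h Hh.
  assert (K1 := Rmin_l d1 d2). assert (K2 := Rmin_r d1 d2).
  specialize (H1 h ltac:(lra)). specialize (H2 h ltac:(lra)). unfold F.
  set (A := Cmod (g (u + h)%C) ^ 2) in *. set (B := Cmod (g u) ^ 2) in *.
  set (A' := Cmod (u + h)%C ^ 2) in *. set (B' := Cmod u ^ 2) in *.
  replace (A + eps * A' - (B + eps * B')) with ((A - B) + eps * (A' - B')) by ring.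
  eapply Rle_lt_trans; [apply Rabs_triang|]. rewrite Rabs_mult, (Rabs_pos_eq eps) by lra.
  apply Rlt_div_r in H2; [|lra]. lra. }
assert (Hgz : Cmod (g z) ^ 2 <= F z0).
{ eapply Rle_trans; [|apply (Hmax z Hz)]. unfold F. pose proof (pow2_ge_0 (Cmod z)). nra. }
destruct Hz0 as [Hlt|Heq].
2: { eapply Rle_trans; [exact Hgz|]. unfold F. rewrite Heq.
  assert (Cmod (g z0) ^ 2 <= M ^ 2).
  { apply pow_incr. split; [apply Cmod_ge_0|apply Hb, Heq]. }
  assert (r ^ 2 <= 1) by nra. nra. }
exfalso.
(* The closed disc of radius [rho] about [z0] must stay in the disc of radius [r], and must avoid
   the possible singularity 0 except when [z0] is 0 itself. *)
assert (Rho : exists rho, 0 < rho <= r - Cmod z0 /\ (z0 <> 0%C -> rho < Cmod z0)).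
{ destruct (classic (z0 = 0%C)) as [E|N].
  - exists (r - Cmod z0). split; [lra|]. intros N; contradiction.
  - apply Cmod_gt_0 in N. exists (Rmin (r - Cmod z0) (Cmod z0 / 2)).
    assert (K1 := Rmin_l (r - Cmod z0) (Cmod z0 / 2)).
    assert (K2 := Rmin_r (r - Cmod z0) (Cmod z0 / 2)).
    repeat split; [apply Rmin_pos; lra|lra|lra]. }
destruct Rho as (rho & Hrho & Hrho0).
(* Polarisation: F(z) = |g(z) - g(z0)|^2 + eps |z - z0|^2 + Re H(z) - F(z0), and Re H(z0) = 2 F(z0).
   Hence F(z) <= F(z0) gives Re H(z) <= Re H(z0) - eps |z - z0|^2, a strict maximum of the real part
   of a holomorphic function. *)
pose (H := fun z => (2 * Cconj (g z0) * g z + 2 * eps * Cconj z0 * z)%C).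
assert (Hin : forall u, 0 < Cmod (u - z0)%C <= rho -> 0 < Cmod u < 1).
{ intros u Hu. split.
  - destruct (classic (z0 = 0%C)) as [E|N].
    + rewrite E in Hu. replace (u - 0)%C with u in Hu by ring. lra.
    + specialize (Hrho0 N).
      assert (T := Cmod_triangle u (- (u - z0))). rewrite Cmod_opp in T.
      replace (u + - (u - z0))%C with z0 in T by ring. lra.
  - assert (T := Cmod_triangle (u - z0) z0).
    replace (u - z0 + z0)%C with u in T by ring. lra. }
apply (no_strict_max_on_circle H z0 rho (eps * rho ^ 2)).
- lra.
- apply Rmult_lt_0_compat; [lra|apply pow_lt; lra].
- intros u Hu. destruct (Hg u (Hin u Hu)) as [L HL]. eexists. unfold H.
  apply cdiff_plus.
  + apply cdiff_mult; [apply cdiff_const|exact HL].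
  + apply cdiff_mult; [apply cdiff_const|apply cdiff_id].
- destruct (classic (z0 = 0%C)) as [E|N].
  + intros e Hepos. set (K := Cmod (2 * Cconj (g z0))%C + Cmod (2 * eps * Cconj z0)%C + 1).
    pose proof (Cmod_ge_0 (2 * Cconj (g z0))%C) as P1.
    pose proof (Cmod_ge_0 (2 * eps * Cconj z0)%C) as P2.
    assert (HK : 0 < K) by (unfold K; lra).
    assert (HeK : 0 < e / (2 * K)) by (apply Rdiv_lt_0_compat; lra).
    destruct (Hcont z0 ltac:(lra) _ HeK) as (d & Hd & H1).
    exists (Rmin d (e / (2 * K))). split; [apply Rmin_pos; assumption|].
    intros h Hh.
    assert (K1 := Rmin_l d (e / (2 * K))). assert (K2 := Rmin_r d (e / (2 * K))).
    specialize (H1 h ltac:(lra)).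
    replace (H (z0 + h)%C - H z0)%C with
      (2 * Cconj (g z0) * (g (z0 + h) - g z0) + 2 * eps * Cconj z0 * h)%C
      by (unfold H; ring).
    eapply Rle_lt_trans; [apply Cmod_triangle|].
    rewrite (Cmod_mult (2 * Cconj (g z0))%C), (Cmod_mult (2 * eps * Cconj z0)%C).
    replace e with (K * (e / (2 * K)) + K * (e / (2 * K))) by (field; lra).
    pose proof (Cmod_ge_0 h). pose proof (Cmod_ge_0 (g (z0 + h) - g z0)%C).
    apply Rplus_le_lt_compat.
    * apply Rmult_le_compat; try lra. unfold K; lra.
    * apply Rle_lt_trans with (K * Cmod h).
      -- apply Rmult_le_compat_r; [lra|unfold K; lra].
      -- apply Rmult_lt_compat_l; lra.
  + apply Cmod_gt_0 in N. destruct (Hg z0 ltac:(lra)) as [L HL].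
    apply cdiff_ccont with (2 * Cconj (g z0) * L + 2 * eps * Cconj z0 * 1)%C. unfold H.
    replace (2 * Cconj (g z0) * L + 2 * eps * Cconj z0 * 1)%C with
      ((0 * g z0 + 2 * Cconj (g z0) * L) + (0 * z0 + 2 * eps * Cconj z0 * 1))%C by ring.
    apply cdiff_plus.
    * apply (cdiff_mult (fun _ => (2 * Cconj (g z0))%C)); [apply cdiff_const|exact HL].
    * apply (cdiff_mult (fun _ => (2 * eps * Cconj z0)%C) (fun z => z));
        [apply cdiff_const|apply cdiff_id].
- intros u Hu.
  assert (T := Cmod_triangle (u - z0) z0).
  replace (u - z0 + z0)%C with u in T by ring.
  assert (Hm := Hmax u ltac:(lra)). unfold F in Hm.
  rewrite !Cmod_sqr in Hm.
  assert (Hu2 : Cmod (u - z0)%C ^ 2 = rho ^ 2) by (rewrite Hu; reflexivity).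
  rewrite Cmod_sqr in Hu2. rewrite <- Hu2.
  unfold H. clear - Hm. destruct (g u) as [a b], (g z0) as [a0 b0], u as [x y], z0 as [x0 y0].
  assert (S1 := pow2_ge_0 (a - a0)). assert (S2 := pow2_ge_0 (b - b0)).
  simpl in *. lra.
Qed.

(** The first-order expansion of [w] at 0 gives continuity of the quotient there, which is exactly
    what [max_modulus] asks for at the origin. *)
Lemma ccont_div_id (w : C -> C) (L : C) : w 0%C = 0%C -> cdiff w 0%C L ->
  ccont (fun z => if Req_EM_T (Cmod z) 0 then L else (w z / z)%C) 0%C.
Proof.
intros H0 H eps He. destruct (H (eps / 2) ltac:(lra)) as (d & Hd & H1).
exists d. split; [exact Hd|]. intros h Hh. specialize (H1 h Hh).
rewrite Cplus_0_l in *. rewrite H0 in H1. rewrite Cmod_0.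
destruct (Req_EM_T 0 0) as [_|n]; [|lra].
destruct (Req_EM_T (Cmod h) 0) as [E|N].
- replace (L - L)%C with (RtoC 0) by ring. rewrite Cmod_0. exact He.
- assert (P : 0 < Cmod h) by (pose proof (Cmod_ge_0 h); lra).
  assert (Nh : h <> 0%C) by (apply Cmod_gt_0, P).
  replace (w h / h - L)%C with ((w h - 0 - L * h) / h)%C by (field; exact Nh).
  rewrite Cmod_div by exact Nh. apply Rlt_div_l; [exact P|]. nra.
Qed.

Lemma cdiff_div_id (w : C -> C) (a z : C) (L : C) : z <> 0%C -> cdiff w z L ->
  exists M, cdiff (fun z => if Req_EM_T (Cmod z) 0 then a else (w z / z)%C) z M.
Proof.
intros N H. eexists.
apply (cdiff_ext_loc (fun z => w z * / z)%C) with (r := Cmod z).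
- apply Cmod_gt_0, N.
- intros h Hh. destruct (Req_EM_T (Cmod (z + h)) 0) as [E|_]; [|reflexivity].
  apply Cmod_eq_0 in E. exfalso.
  assert (h = (- z)%C) by (replace h with (z + h - z)%C by ring; rewrite E; ring).
  subst h. rewrite Cmod_opp in Hh. lra.
- apply cdiff_mult; [exact H|apply cdiff_inv, N].
Qed.

(** On |z| = r the quotient g = w(z)/z has modulus at most 1/r, hence also inside; letting r tend to
    1 is replaced by one well-chosen [r]. *)
Lemma schwarz_lemma (w : C -> C) :
  (forall z, Cmod z < 1 -> exists L, cdiff w z L) ->
  (forall z, Cmod z < 1 -> Cmod (w z) < 1) -> w 0%C = 0%C ->
  forall z, Cmod z < 1 -> Cmod (w z) <= Cmod z.
Proof.
intros Hd Hw H0 z Hz.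
destruct (classic (z = 0%C)) as [->|N]; [rewrite H0; lra|].
destruct (Hd 0%C) as [L HL]; [rewrite Cmod_0; lra|].
pose (g := fun z => if Req_EM_T (Cmod z) 0 then L else (w z / z)%C).
assert (P : 0 < Cmod z) by (apply Cmod_gt_0, N).
assert (Eg : forall u, 0 < Cmod u -> Cmod (g u) = Cmod (w u) / Cmod u).
{ intros u Hu. unfold g. destruct (Req_EM_T (Cmod u) 0) as [E|_]; [lra|].
  apply Cmod_div. apply Cmod_gt_0, Hu. }
assert (G : Cmod (g z) ^ 2 <= 1).
{ apply Rnot_lt_le. intros Hgt. set (A := Cmod (g z) ^ 2) in *.
  (* If A = |g(z)|^2 > 1, then r >= (1 + t)/2 gives r^2 > t, that is 1/r^2 < (A + 1)/2; with error
     (A - 1)/2 in the maximum principle this yields A < A. *)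
  set (t := 2 / (A + 1)).
  assert (Ht : 0 < t < 1).
  { unfold t. split; [apply Rdiv_lt_0_compat; lra|]. apply Rlt_div_l; lra. }
  set (r := Rmax ((1 + Cmod z) / 2) ((1 + t) / 2)).
  assert (R1 := Rmax_l ((1 + Cmod z) / 2) ((1 + t) / 2)).
  assert (R2 := Rmax_r ((1 + Cmod z) / 2) ((1 + t) / 2)).
  assert (R3 : r < 1) by (apply Rmax_lub_lt; lra).
  fold r in R1, R2.
  assert (X : A <= (/ r) ^ 2 + (A - 1) / 2).
  { apply (max_modulus g r (/ r)); try lra.
    - left. apply Rinv_0_lt_compat. lra.
    - intros u Hu. destruct (Hd u ltac:(lra)) as [M HM].
      apply (cdiff_div_id w L u M); [apply Cmod_gt_0; lra|exact HM].
    - apply ccont_div_id; assumption.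
    - intros u Hu. rewrite Eg by lra. rewrite Hu. apply Rle_div_l; [lra|].
      rewrite Rinv_l by lra. left. apply Hw. lra. }
  assert (Y : (/ r) ^ 2 < (A + 1) / 2).
  { assert (t < r ^ 2) by nra.
    replace ((A + 1) / 2) with (/ t) by (unfold t; field; lra).
    rewrite pow_inv. apply Rinv_lt_contravar; [|assumption]. apply Rmult_lt_0_compat; lra. }
  lra. }
rewrite Eg in G by exact P.
assert (Q : Cmod (w z) / Cmod z <= 1).
{ apply Rnot_lt_le. intros Hc. nra. }
apply Rle_div_l in Q; lra.
Qed.

(** * Primitives on the unit disc *)

(** Ensures that segments parallel to the axes between two points of the unit disc stay in it. *)
Lemma between_sqr (a b t : R) : Rmin a b <= t <= Rmax a b -> t ^ 2 <= a ^ 2 \/ t ^ 2 <= b ^ 2.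
Proof.
intros H. unfold Rmin, Rmax in H.
destruct (Rle_dec a b); destruct (Rle_dec 0 t); (left; nra) || (right; nra).
Qed.

Lemma RInt_swap_R (f : R -> R) a b : ex_RInt f a b -> RInt f b a = - RInt f a b.
Proof. intros H. symmetry. exact (opp_RInt_swap f a b H). Qed.

Lemma Rmin_Rmax_mem (a b : R) : Rmin a b <= a <= Rmax a b /\ Rmin a b <= b <= Rmax a b.
Proof. repeat split; [apply Rmin_l|apply Rmax_l|apply Rmin_r|apply Rmax_r]. Qed.

(** Reversing an interval only changes signs. Needed because potentials are integrated from 0 to
    endpoints of either sign. *)
Lemma goursat_oriented (P Q : R -> R -> R) (a b c d : R) :
  (forall x y, Rmin a b <= x <= Rmax a b -> Rmin c d <= y <= Rmax c d -> closed_at P Q x y) ->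
  loop_integral P Q a b c d = 0.
Proof.
intros H.
destruct (Rmin_Rmax_mem a b) as [Ha Hb]. destruct (Rmin_Rmax_mem c d) as [Hc Hd].
assert (XP : forall y, Rmin c d <= y <= Rmax c d -> ex_RInt (fun t => P t y) a b).
{ intros y Hy. apply ex_RInt_slice_x_oriented. intros t Ht. apply (closed_at_cont1 P Q), H; assumption. }
assert (XQ : forall x, Rmin a b <= x <= Rmax a b -> ex_RInt (fun t => Q x t) c d).
{ intros x Hx. apply ex_RInt_slice_y_oriented. intros t Ht. apply (closed_at_cont2 P Q), H; assumption. }
assert (E1 := RInt_swap_R _ _ _ (XP c Hc)). assert (E2 := RInt_swap_R _ _ _ (XP d Hd)).
assert (E3 := RInt_swap_R _ _ _ (XQ a Ha)). assert (E4 := RInt_swap_R _ _ _ (XQ b Hb)).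
destruct (Rle_lt_dec a b) as [Hab|Hab]; destruct (Rle_lt_dec c d) as [Hcd|Hcd].
- apply goursat; [exact Hab|exact Hcd|]. intros x y Hx Hy. apply H;
    rewrite Rmin_left, Rmax_right; assumption.
- assert (G := goursat P Q a b d c Hab ltac:(lra)). unfold loop_integral in *.
  lapply G; [lra|]. intros x y Hx Hy.
  apply H; [rewrite Rmin_left, Rmax_right|rewrite Rmin_right, Rmax_left]; lra.
- assert (G := goursat P Q b a c d ltac:(lra) Hcd). unfold loop_integral in *.
  lapply G; [lra|]. intros x y Hx Hy.
  apply H; [rewrite Rmin_right, Rmax_left|rewrite Rmin_left, Rmax_right]; lra.
- assert (G := goursat P Q b a d c ltac:(lra) ltac:(lra)). unfold loop_integral in *.
  lapply G; [lra|]. intros x y Hx Hy.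
  apply H; rewrite Rmin_right, Rmax_left; lra.
Qed.

Lemma RInt_near_const (f : R -> R) (s t c e : R) :
  ex_RInt f s t -> (forall u, Rmin s t <= u <= Rmax s t -> Rabs (f u - c) <= e) ->
  Rabs (RInt f s t - c * (t - s)) <= Rabs (t - s) * e.
Proof.
assert (Main : forall s t, s <= t -> ex_RInt f s t ->
  (forall u, s <= u <= t -> Rabs (f u - c) <= e) ->
  Rabs (RInt f s t - c * (t - s)) <= Rabs (t - s) * e).
{ clear. intros s t Hst Hf He. rewrite (Rabs_pos_eq (t - s)) by lra.
  assert (A := RInt_near_affine f s t c 0 0 e Hst Hf).
  replace (RInt f s t - c * (t - s)) with
    (RInt f s t - (c * (t - s) + 0 * ((t - 0) ^ 2 - (s - 0) ^ 2) / 2)) by field.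
  apply A. intros u Hu. replace (f u - (c + 0 * (u - 0))) with (f u - c) by ring.
  apply He, Hu. }
intros Hf He. destruct (Rle_lt_dec s t) as [Hst|Hst].
- apply Main; [exact Hst|exact Hf|]. rewrite Rmin_left, Rmax_right in He by exact Hst. exact He.
- rewrite Rmin_right, Rmax_left in He by lra.
  assert (A := Main t s ltac:(lra) (ex_RInt_swap _ _ _ Hf) He).
  rewrite (RInt_swap_R f s t Hf) in A.
  rewrite <- (Rabs_Ropp (t - s)), <- Rabs_Ropp.
  replace (- (RInt f s t - c * (t - s))) with (- RInt f s t - c * (s - t)) by ring.
  replace (- (t - s)) with (s - t) by ring. exact A.
Qed.

Lemma unit_disc_open (x y : R) : x ^ 2 + y ^ 2 < 1 ->
  locally_2d (fun u v => u ^ 2 + v ^ 2 < 1) x y.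
Proof.
intros H.
assert (K : continuity_2d_pt (fun u v => u * u + v * v) x y).
{ apply continuity_2d_pt_plus; apply continuity_2d_pt_mult;
    apply continuity_2d_pt_id1 || apply continuity_2d_pt_id2. }
assert (He : 0 < 1 - (x ^ 2 + y ^ 2)) by lra.
destruct (K (mkposreal _ He)) as [d Hd]. exists d. intros u v Hu Hv.
specialize (Hd u v Hu Hv). simpl in Hd. apply Rabs_lt_between in Hd. simpl. lra.
Qed.

(** [U] integrates along the path from 0 to (x, 0) to (x, y). Vertical increments are integrals of
    [Q] by construction; horizontal ones are integrals of [P] by Goursat on the rectangle between
    abscissae x, x' and ordinates 0, y, which lies in the disc. *)
Lemma closed_form_potential (P Q : R -> R -> R) :
  (forall x y, x ^ 2 + y ^ 2 < 1 -> closed_at P Q x y) ->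
  exists U : R -> R -> R, U 0 0 = 0 /\
    forall x y, x ^ 2 + y ^ 2 < 1 -> differentiable_pt_lim U x y (P x y) (Q x y).
Proof.
intros H.
pose (U := fun x y => RInt (fun t => P t 0) 0 x + RInt (fun t => Q x t) 0 y).
exists U. split.
{ unfold U. rewrite !RInt_point. unfold zero; simpl. ring. }
assert (XQ : forall x y y', x ^ 2 + y ^ 2 < 1 -> x ^ 2 + y' ^ 2 < 1 ->
  ex_RInt (fun t => Q x t) y y').
{ intros x y y' H1 H2. apply ex_RInt_slice_y_oriented. intros t Ht. apply (closed_at_cont2 P Q), H.
  destruct (between_sqr y y' t Ht); lra. }
assert (XP : forall x x' y, x ^ 2 + y ^ 2 < 1 -> x' ^ 2 + y ^ 2 < 1 ->
  ex_RInt (fun t => P t y) x x').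
{ intros x x' y H1 H2. apply ex_RInt_slice_x_oriented. intros t Ht. apply (closed_at_cont1 P Q), H.
  destruct (between_sqr x x' t Ht); lra. }
assert (X0 : forall x y, x ^ 2 + y ^ 2 < 1 -> x ^ 2 + 0 ^ 2 < 1) by (intros; nra).
assert (UY : forall x y y', x ^ 2 + y ^ 2 < 1 -> x ^ 2 + y' ^ 2 < 1 ->
  U x y' - U x y = RInt (fun t => Q x t) y y').
{ intros x y y' H1 H2. unfold U.
  rewrite (RInt_Chasles_R (fun t => Q x t) 0 y y').
  - ring.
  - apply XQ; [apply (X0 x y H1)|exact H1].
  - apply XQ; assumption. }
assert (UX : forall x x' y, x ^ 2 + y ^ 2 < 1 -> x' ^ 2 + y ^ 2 < 1 ->
  U x' y - U x y = RInt (fun t => P t y) x x').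
{ intros x x' y H1 H2. unfold U.
  rewrite (RInt_Chasles_R (fun t => P t 0) 0 x x').
  - assert (G := goursat_oriented P Q x x' 0 y). unfold loop_integral in G.
    lapply G; [lra|]. intros u v Hu Hv. apply H.
    destruct (between_sqr x x' u Hu); destruct (between_sqr 0 y v Hv); nra.
  - apply XP; [simpl; lra|apply (X0 x y H1)].
  - apply XP; [apply (X0 x y H1)|apply (X0 x' y H2)]. }
intros x y Hxy eps.
assert (He : 0 < eps / 2) by (pose proof (cond_pos eps); lra).
destruct (closed_at_cont1 P Q x y (H x y Hxy) (mkposreal _ He)) as [d1 H1].
destruct (closed_at_cont2 P Q x y (H x y Hxy) (mkposreal _ He)) as [d2 H2].
destruct (unit_disc_open x y Hxy) as [d3 H3]. simpl in H1, H2.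
assert (Hd : 0 < Rmin d1 (Rmin d2 d3)) by (repeat apply Rmin_pos; apply cond_pos).
exists (mkposreal _ Hd). simpl. intros u v Hu Hv.
assert (K1 := Rmin_l d1 (Rmin d2 d3)). assert (K2 := Rmin_r d1 (Rmin d2 d3)).
assert (K3 := Rmin_l d2 d3). assert (K4 := Rmin_r d2 d3).
assert (Z : Rabs (y - y) < Rmin d1 (Rmin d2 d3)).
{ rewrite Rminus_diag, Rabs_R0. exact Hd. }
assert (Huv := H3 u v ltac:(lra) ltac:(lra)).
assert (Huy := H3 u y ltac:(lra) ltac:(lra)).
assert (B : forall s t r, Rmin s t <= r <= Rmax s t -> Rabs (r - s) <= Rabs (t - s)).
{ clear. intros s t r Hr. unfold Rmin, Rmax in Hr. destruct (Rle_dec s t).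
  - rewrite !Rabs_pos_eq; lra.
  - rewrite !Rabs_left1; lra. }
assert (E1 := RInt_near_const (fun t => Q u t) y v (Q x y) (eps / 2) (XQ u y v Huy Huv)).
assert (E2 := RInt_near_const (fun t => P t y) x u (P x y) (eps / 2) (XP x u y Hxy Huy)).
rewrite <- UY in E1 by assumption. rewrite <- UX in E2 by assumption.
lapply E1. 2: { intros t Ht. assert (Bt := B _ _ _ Ht). left. apply H2; lra. }
lapply E2. 2: { intros t Ht. assert (Bt := B _ _ _ Ht). left. apply H1; lra. }
intros F1 F2.
(* The increment is split at the corner (u, y), which lies in the disc as well. *)
replace (U u v - U x y - (P x y * (u - x) + Q x y * (v - y))) with
  ((U u v - U u y - Q x y * (v - y)) + (U u y - U x y - P x y * (u - x))) by ring.
eapply Rle_trans; [apply Rabs_triang|].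
assert (M1 := Rmax_l (Rabs (u - x)) (Rabs (v - y))).
assert (M2 := Rmax_r (Rabs (u - x)) (Rabs (v - y))).
nra.
Qed.

Lemma Cmod_lt_1_sqr (x y : R) : Cmod (x, y) < 1 <-> x ^ 2 + y ^ 2 < 1.
Proof.
assert (E := Cmod_sqr (x, y)). cbn [fst snd] in E. rewrite <- E. pose proof (Cmod_ge_0 (x, y)). split; intros; nra.
Qed.

(** The potentials of Re (g dz) and Im (g dz) are the two components of the primitive. *)
Lemma primitive_unit_disc (g : C -> C) :
  (forall z, Cmod z < 1 -> exists L, cdiff g z L) ->
  exists G : C -> C, G 0%C = 0%C /\ forall z, Cmod z < 1 -> cdiff G z (g z).
Proof.
intros Hg.
destruct (closed_form_potential (fun x y => fst (g (x, y))) (fun x y => - snd (g (x, y))))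
  as (U & U0 & HU).
{ intros x y Hxy. apply Cmod_lt_1_sqr in Hxy. destruct (Hg _ Hxy) as [L HL].
  exact (cdiff_closed_re g x y L HL). }
destruct (closed_form_potential (fun x y => snd (g (x, y))) (fun x y => fst (g (x, y))))
  as (V & V0 & HV).
{ intros x y Hxy. apply Cmod_lt_1_sqr in Hxy. destruct (Hg _ Hxy) as [L HL].
  exact (cdiff_closed_im g x y L HL). }
exists (fun z => (U (fst z) (snd z), V (fst z) (snd z))).
split.
{ simpl. rewrite U0, V0. reflexivity. }
intros [x y] Hz eps He. apply Cmod_lt_1_sqr in Hz.
assert (He2 : 0 < eps / 2) by lra.
destruct (HU x y Hz (mkposreal _ He2)) as [d1 H1].
destruct (HV x y Hz (mkposreal _ He2)) as [d2 H2]. simpl in H1, H2.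
exists (Rmin d1 d2). split; [apply Rmin_pos; apply cond_pos|].
intros h Hh.
assert (K1 := Rmin_l d1 d2). assert (K2 := Rmin_r d1 d2).
assert (A1 := Rabs_fst_le h). assert (A2 := Rabs_snd_le h).
assert (Eq : forall s t : R, s + t - s = t) by (intros; ring).
specialize (H1 (x + fst h) (y + snd h)). specialize (H2 (x + fst h) (y + snd h)).
rewrite !Eq in H1, H2.
specialize (H1 ltac:(lra) ltac:(lra)). specialize (H2 ltac:(lra) ltac:(lra)).
assert (M : Rmax (Rabs (fst h)) (Rabs (snd h)) <= Cmod h) by apply Rmax_Cmod.
eapply Rle_trans; [apply Cmod_le_sum|].
replace (eps * Cmod h) with (eps / 2 * Cmod h + eps / 2 * Cmod h) by field.
apply Rplus_le_compat.
- eapply Rle_trans; [|apply (Rmult_le_compat_l (eps / 2)), M; lra].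
  eapply Rle_trans; [|exact H1]. apply Req_le. f_equal. simpl. ring.
- eapply Rle_trans; [|apply (Rmult_le_compat_l (eps / 2)), M; lra].
  eapply Rle_trans; [|exact H2]. apply Req_le. f_equal. simpl. ring.
Qed.

(** * The nephroid domain *)

Lemma cdiff_unique (f : C -> C) (z L M : C) : cdiff f z L -> cdiff f z M -> L = M.
Proof.
intros HL HM. apply NNPP. intros N.
assert (P : 0 < Cmod (L - M)%C).
{ apply Cmod_gt_0. intros E. apply N. replace L with (L - M + M)%C by ring. rewrite E. ring. }
destruct (HL (Cmod (L - M)%C / 4) ltac:(lra)) as (d1 & Hd1 & H1).
destruct (HM (Cmod (L - M)%C / 4) ltac:(lra)) as (d2 & Hd2 & H2).
assert (Hd : 0 < Rmin d1 d2) by (apply Rmin_pos; assumption).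
assert (K1 := Rmin_l d1 d2). assert (K2 := Rmin_r d1 d2).
set (h := RtoC (Rmin d1 d2 / 2)).
assert (Eh : Cmod h = Rmin d1 d2 / 2) by (unfold h; rewrite Cmod_R, Rabs_pos_eq; lra).
specialize (H1 h ltac:(lra)). specialize (H2 h ltac:(lra)).
assert (T := Cmod_triangle (f (z + h)%C - f z - M * h)%C (- (f (z + h)%C - f z - L * h))%C).
rewrite Cmod_opp in T.
replace (f (z + h) - f z - M * h + - (f (z + h) - f z - L * h))%C with ((L - M) * h)%C
  in T by ring.
rewrite Cmod_mult, Eh in T. rewrite Eh in H1, H2. nra.
Qed.

Lemma Qf_at_intro (f : C -> C) (z L q : C) :
  f z <> 0%C -> cdiff f z L -> (z * L)%C = (q * f z)%C -> Qf_at f z q.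
Proof.
intros Nf HL E. split; [exact Nf|]. intros M HM. apply has_cderiv_cdiff in HM.
rewrite (cdiff_unique f z M L HM HL).
change ((z * L / f z)%C = q). rewrite E. field. exact Nf.
Qed.

(* The witness is [f z = z exp (int_0^z (phi t - 1) / t dt)]. *)
Lemma extremal_function (phi g : C -> C) :
  (forall z, Cmod z < 1 -> exists L, cdiff g z L) ->
  (forall z, Cmod z < 1 -> phi z = (1 + z * g z)%C) ->
  exists f : C -> C, starlike_wrt phi f /\
    forall z, Cmod z < 1 -> z <> 0%C -> Qf_at f z (phi z).
Proof.
intros Hg Hphi. destruct (primitive_unit_disc g Hg) as (G & G0 & HG).
pose (f := fun z : C => (z * Cexp (G z))%C).
assert (Hf : forall z, Cmod z < 1 -> cdiff f z (phi z * Cexp (G z))%C).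
{ intros z Hz. rewrite Hphi by exact Hz.
  replace ((1 + z * g z) * Cexp (G z))%C with
    (1 * Cexp (G z) + z * (Cexp (G z) * g z))%C by ring.
  apply (cdiff_mult (fun z => z) (fun z => Cexp (G z))); [apply cdiff_id|].
  apply (cdiff_comp Cexp G); [apply cdiff_exp|apply HG, Hz]. }
assert (HQ : forall z, Cmod z < 1 -> z <> 0%C -> Qf_at f z (phi z)).
{ intros z Hz N. apply (Qf_at_intro f z (phi z * Cexp (G z))%C).
  - apply Cmult_neq_0; [exact N|apply Cexp_neq_0].
  - apply Hf, Hz.
  - unfold f. ring. }
exists f. split; [|exact HQ]. split; [split; [|split]|].
- intros z Hz. eexists. apply has_cderiv_cdiff, Hf, Hz.
- change (f 0%C = 0%C). unfold f. ring.
- apply has_cderiv_cdiff. change (cdiff f 0%C 1%C).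
  assert (H0 : Cmod 0%C < 1) by (rewrite Cmod_0; lra).
  assert (X := Hf 0%C H0). rewrite Hphi, G0, Cexp_0 in X by exact H0.
  replace ((1 + 0 * g 0) * 1)%C with (RtoC 1) in X by ring. exact X.
(* The Schwarz function of the extremal function is the identity. *)
- exists (fun z => z). split; [|split; [|split]].
  + intros z _. eexists. apply has_cderiv_cdiff, cdiff_id.
  + intros z Hz. exact Hz.
  + reflexivity.
  + exact HQ.
Qed.

(* A root of [z - z^3/3 = q - 1] is a fixed point of [z |-> (q - 1) + z^3/3], a
   contraction of the closed disc of radius [1/3 + |q - 1|]; the displacement
   [|T z - z|] attains its minimum there. *)
Lemma Omega_Ne_disc (q : C) : Cmod (q - 1)%C < 2 / 3 -> Omega_Ne q.
Proof.
(* With this [r] the disc is mapped into itself, as |p| + r^3/3 <= |p| + 1/3 = r; the bound |p| <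
   2/3 is what makes r < 1. *)
intros Hq. set (p := (q - 1)%C) in *. set (r := 1 / 3 + Cmod p).
assert (Pp : 0 <= Cmod p) by apply Cmod_ge_0.
assert (Hr : 0 < r < 1) by (unfold r; lra).
pose (T := fun z : C => (p + z * (z * z) * / 3)%C).
assert (N3 : (3 : C) <> 0%C) by (apply RtoC_neq_0; lra).
assert (M3 : Cmod (/ 3)%C = / 3).
{ rewrite Cmod_inv, Cmod_R, Rabs_pos_eq by (lra || exact N3). reflexivity. }
assert (HT : forall z, Cmod z <= r -> Cmod (T z) <= r).
{ intros z Hz. unfold T. eapply Rle_trans; [apply Cmod_triangle|].
  rewrite !Cmod_mult, M3. pose proof (Cmod_ge_0 z).
  assert (Cmod z * (Cmod z * Cmod z) <= r * (r * r)).
  { repeat apply Rmult_le_compat; nra. }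
  assert (r * (r * r) <= 1) by nra.
  assert (Cmod p = r - 1 / 3) by (unfold r; ring). lra. }
pose (F := fun z : C => - Cmod (T z - z)%C ^ 2).
assert (Hcont : forall z, ccont (fun z => T z - z)%C z).
{ intros z. eapply cdiff_ccont. apply cdiff_plus.
  - apply cdiff_plus; [apply cdiff_const|]. apply cdiff_mult; [|apply cdiff_const].
    apply cdiff_mult; [apply cdiff_id|]. apply cdiff_mult; apply cdiff_id.
  - apply (cdiff_ext_loc (fun z => (-(1)) * z)%C) with (r := 1); [lra|intros; ring|].
    apply cdiff_mult; [apply cdiff_const|apply cdiff_id]. }
destruct (disc_max F r ltac:(lra)) as (z0 & Hz0 & Hmin).
{ intros z _ eps He.
  destruct (ccont_Cmod_sqr _ z (Hcont z) eps He) as (d & Hd & H).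
  exists d. split; [exact Hd|]. intros h Hh. unfold F.
  rewrite <- Rabs_Ropp.
  replace (- (- Cmod (T (z + h) - (z + h))%C ^ 2 - - Cmod (T z - z)%C ^ 2)) with
    (Cmod (T (z + h) - (z + h))%C ^ 2 - Cmod (T z - z)%C ^ 2) by ring.
  apply H, Hh. }
assert (Hc : Cmod (T (T z0) - T z0)%C <= r ^ 2 * Cmod (T z0 - z0)%C).
{ set (u := T z0). assert (Hu : Cmod u <= r) by (apply HT, Hz0).
  change (Cmod (T u - T z0)%C <= r ^ 2 * Cmod (u - z0)%C).
  replace (T u - T z0)%C with ((u * u + u * z0 + z0 * z0) * / 3 * (u - z0))%C
    by (unfold T; ring).
  rewrite !Cmod_mult, M3. apply Rmult_le_compat_r; [apply Cmod_ge_0|].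
  assert (Cmod (u * u + u * z0 + z0 * z0)%C <= 3 * r ^ 2).
  { eapply Rle_trans; [apply Cmod_triangle|].
    eapply Rle_trans; [apply Rplus_le_compat_r, Cmod_triangle|].
    rewrite !Cmod_mult. pose proof (Cmod_ge_0 u). pose proof (Cmod_ge_0 z0).
    assert (Cmod u * Cmod u <= r * r) by (apply Rmult_le_compat; lra).
    assert (Cmod u * Cmod z0 <= r * r) by (apply Rmult_le_compat; lra).
    assert (Cmod z0 * Cmod z0 <= r * r) by (apply Rmult_le_compat; lra).
    simpl. lra. }
  lra. }
assert (Hm := Hmin (T z0) (HT z0 Hz0)). unfold F in Hm.
set (a := Cmod (T z0 - z0)%C) in *. set (b := Cmod (T (T z0) - T z0)%C) in *.
assert (Pa : 0 <= a) by apply Cmod_ge_0. assert (Pb : 0 <= b) by apply Cmod_ge_0.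
(* Minimality of the displacement at [z0] gives a <= b, while contraction gives b <= r^2 a with r <
   1. *)
assert (Ea : a = 0).
{ destruct Pa as [Pa|Pa]; [|symmetry; exact Pa]. exfalso.
  assert (r ^ 2 < 1) by nra. assert (b < a) by nra. nra. }
apply Cmod_eq_0 in Ea.
exists z0. split; [change (Cmod z0 < 1); lra|].
change (q = (1 + z0 - z0 * (z0 * z0) / 3)%C).
replace q with (1 + p)%C by (unfold p; ring).
replace (1 + p)%C with (1 + z0 - z0 * (z0 * z0) / 3 + (T z0 - z0))%C
  by (unfold T, Cdiv; ring).
rewrite Ea. ring.
Qed.

(** Im [phi_Ne] = y (1 - x^2 + y^2/3), and the second factor is positive on the disc, so a real
    value has a real preimage x. On (-1, 1) the values of x - x^3/3 lie strictly between -2/3 and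
    2/3. *)
Lemma Omega_Ne_real (p : R) : Omega_Ne (1 + p, 0) -> Rabs p < 2 / 3.
Proof.
intros ([x y] & Hz & E).
change (Cmod (x, y) < 1) in Hz. apply Cmod_lt_1_sqr in Hz.
assert (E1 := f_equal fst E). assert (E2 := f_equal snd E). simpl in E1, E2.
assert (F1 : p = x - (x * (x * x) - 3 * x * y * y) / 3).
{ field_simplify in E1. lra. }
assert (F2 : y * (1 - x ^ 2 + y ^ 2 / 3) = 0).
{ field_simplify in E2. lra. }
assert (y = 0).
{ apply Rmult_integral in F2. destruct F2 as [?|?]; [assumption|nra]. }
subst y. assert (Hx : -1 < x < 1) by (split; nra).
rewrite F1. apply Rabs_def1; nra.
Qed.

(** Reduces each class to estimates on [phi]. The sign of [s] is left free because the extremal real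
    point may be negative; for r = 1 sharpness is vacuous. *)
Lemma Ne_radius_criterion (phi g : C -> C) (r : R) :
  0 < r <= 1 ->
  (forall z, Cmod z < 1 -> exists L, cdiff g z L) ->
  (forall z, Cmod z < 1 -> phi z = (1 + z * g z)%C) ->
  (forall z, Cmod z < r -> Cmod (phi z - 1)%C < 2 / 3) ->
  (forall t, r < t < 1 -> exists s p : R,
     Rabs s = t /\ phi (RtoC s) = (1 + p, 0) /\ 2 / 3 <= Rabs p) ->
  is_Ne_radius (starlike_wrt phi) r.
Proof.
intros Hr Hg Hphi Hin Hout. split; [exact Hr|split].
- intros f (_ & w & Hw & Hw1 & Hw0 & HQ) z Hz N.
  assert (Hz1 : Cmod z < 1) by (change (Cmod z < r) in Hz; lra).
  destruct (HQ z Hz1 N) as [Nf HL]. split; [exact Nf|]. intros L HfL.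
  rewrite (HL L HfL). apply Omega_Ne_disc, Hin.
  eapply Rle_lt_trans; [|exact Hz].
  apply (schwarz_lemma w); [|exact Hw1|exact Hw0|exact Hz1].
  intros u Hu. destruct (Hw u Hu) as [M HM]. exists M. apply has_cderiv_cdiff, HM.
- intros rho Hrho.
  destruct (extremal_function phi g Hg Hphi) as (f & Hf & HQ).
  exists f. split; [exact Hf|]. intros Hmap.
  (* The midpoint lies strictly between [r] and [rho], hence below 1 even if [rho] is 1. *)
  destruct (Hout ((r + rho) / 2) ltac:(lra)) as (s & p & Hs & Hp & Hp2).
  assert (Es : Cmod (RtoC s) = (r + rho) / 2) by (rewrite Cmod_R; exact Hs).
  assert (Hs1 : Cmod (RtoC s) < 1) by lra.
  assert (Ns : RtoC s <> 0%C) by (apply Cmod_gt_0; lra).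
  destruct Hf as [[Han _] _]. destruct (Han (RtoC s) Hs1) as [L HL].
  destruct (HQ (RtoC s) Hs1 Ns) as [_ HQ2].
  assert (Hsr : Cnorm (RtoC s) < rho) by (change (Cmod (RtoC s) < rho); lra).
  destruct (Hmap (RtoC s) Hsr Ns) as [_ Hom].
  specialize (Hom L HL). rewrite (HQ2 L HL), Hp in Hom.
  apply Omega_Ne_real in Hom. lra.
Qed.

(** * The three classes *)

(** By the triangle inequality |z|/|1 - alpha z^2| <= t/(1 - alpha t^2) on |z| = t, with equality at
    z = t. *)
Lemma BS_star_radius (alpha : R) : 0 <= alpha < 1 ->
  is_Ne_radius (BS_star alpha) (4 / (3 + sqrt (9 + 16 * alpha))).
Proof.
intros Ha.
set (s := sqrt (9 + 16 * alpha)).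
assert (Hs2 : s * s = 9 + 16 * alpha) by (apply sqrt_sqrt; lra).
assert (Hs : 3 <= s).
{ rewrite <- (sqrt_pow2 3) by lra. apply sqrt_le_1_alt. lra. }
set (r := 4 / (3 + s)).
assert (Hr3 : r * (3 + s) = 4) by (unfold r; field; lra).
assert (Hr : 0 < r <= 1).
{ split; [apply Rdiv_lt_0_compat; lra|]. apply Rle_div_l; lra. }
(* This is r/(1 - alpha r^2) = 2/3 cleared of denominators. The rationalised form of the positive
   root also covers alpha = 0. *)
assert (Hr2 : 2 * alpha * r ^ 2 + 3 * r = 2).
{ unfold r. replace (2 * alpha) with ((s * s - 9) / 8) by lra. field. lra. }
assert (Low : forall z : C, 1 - alpha * Cmod z ^ 2 <= Cmod (1 - alpha * (z * z))%C).
{ intros z. assert (T := Cmod_triangle (1 - alpha * (z * z)) (alpha * (z * z))).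
  replace (1 - alpha * (z * z) + alpha * (z * z))%C with (RtoC 1) in T by ring.
  rewrite Cmod_1, (Cmod_mult (RtoC alpha)), Cmod_mult, Cmod_R, Rabs_pos_eq in T by lra.
  simpl. lra. }
assert (Pos : forall t, 0 <= t < 1 -> 0 < 1 - alpha * t ^ 2) by (intros; nra).
assert (NZ : forall z : C, Cmod z < 1 -> (1 - alpha * (z * z))%C <> 0%C).
{ intros z Hz. apply Cmod_gt_0. assert (L := Low z).
  assert (P := Pos (Cmod z) (conj (Cmod_ge_0 z) Hz)). lra. }
apply (Ne_radius_criterion (phi_BS alpha) (fun z => / (1 - alpha * (z * z)))%C).
- exact Hr.
- intros z Hz. eexists.
  apply (cdiff_comp Cinv (fun z => 1 - alpha * (z * z))%C).
  + apply cdiff_inv, NZ, Hz.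
  + apply (cdiff_ext_loc (fun z => 1 + (- alpha)%R * (z * z))%C) with (r := 1).
    * lra.
    * intros h _. rewrite RtoC_opp. ring.
    * apply cdiff_plus; [apply cdiff_const|]. apply cdiff_mult; [apply cdiff_const|].
      apply cdiff_mult; apply cdiff_id.
- reflexivity.
- intros z Hz. change (Cmod (1 + z / (1 - alpha * (z * z)) - 1)%C < 2 / 3).
  assert (N := NZ z ltac:(lra)).
  replace (1 + z / (1 - alpha * (z * z)) - 1)%C with (z / (1 - alpha * (z * z)))%C
    by (field; exact N).
  rewrite Cmod_div by exact N. apply Rlt_div_l; [apply Cmod_gt_0, N|].
  assert (L := Low z). pose proof (Cmod_ge_0 z). set (t := Cmod z) in *.
  assert (alpha * t ^ 2 <= alpha * r ^ 2) by (apply Rmult_le_compat_l; [lra|nra]).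
  lra.
- intros t Ht. exists t, (t / (1 - alpha * t ^ 2)).
  assert (P := Pos t ltac:(lra)).
  split; [apply Rabs_pos_eq; lra|split].
  + change ((1 + t / (1 - alpha * (t * t)))%C = RtoC (1 + t / (1 - alpha * t ^ 2))).
    rewrite RtoC_plus, RtoC_div, RtoC_minus, RtoC_mult, RtoC_pow by lra. simpl. do 4 f_equal. ring.
  + rewrite Rabs_pos_eq by (apply Rdiv_le_0_compat; lra).
    apply (Rle_div_r (2 / 3)); [exact P|].
    assert (alpha * r ^ 2 <= alpha * t ^ 2) by (apply Rmult_le_compat_l; [lra|nra]).
    lra.
Qed.

(** * The principal square root and the class [SL_star] *)

Lemma Csqrt_sqr (z : C) : (Csqrt z * Csqrt z)%C = z.
Proof.
destruct z as [x y].
assert (Hm : Cmod (x, y) ^ 2 = x ^ 2 + y ^ 2) by apply (Cmod_sqr (x, y)).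
assert (Hx := Rabs_fst_le (x, y)). simpl fst in Hx. apply Rabs_le_between in Hx.
set (m := Cmod (x, y)) in *.
set (a := sqrt ((m + x) / 2)). set (b := sqrt ((m - x) / 2)).
assert (Ea : a * a = (m + x) / 2) by (apply sqrt_sqrt; lra).
assert (Eb : b * b = (m - x) / 2) by (apply sqrt_sqrt; lra).
assert (Eab : a * b = Rabs y / 2).
{ unfold a, b. rewrite <- sqrt_mult by lra.
  replace ((m + x) / 2 * ((m - x) / 2)) with ((Rabs y / 2) ^ 2).
  - apply sqrt_pow2. pose proof (Rabs_pos y). lra.
  - replace ((Rabs y / 2) ^ 2) with (Rabs y ^ 2 / 4) by field. rewrite pow2_abs.
    replace ((m + x) / 2 * ((m - x) / 2)) with ((m ^ 2 - x ^ 2) / 4) by field. lra. }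
change (Csqrt (x, y)) with ((a, (if Rlt_dec y 0 then -1 else 1) * b) : C).
apply injective_projections; simpl; destruct (Rlt_dec y 0) as [Hy|Hy].
- replace (a * a - -1 * b * (-1 * b)) with (a * a - b * b) by ring. lra.
- replace (a * a - 1 * b * (1 * b)) with (a * a - b * b) by ring. lra.
- rewrite Rabs_left in Eab by exact Hy. lra.
- rewrite Rabs_pos_eq in Eab by lra. lra.
Qed.

Lemma Csqrt_re_pos (z : C) : 0 <= fst (Csqrt z).
Proof. apply sqrt_pos. Qed.

Lemma Csqrt_re_gt_0 (z : C) : 0 < fst z -> 0 < fst (Csqrt z).
Proof.
intros H. unfold Csqrt. simpl fst. apply sqrt_lt_R0.
pose proof (Cmod_ge_0 z). change (Cnorm z) with (Cmod z). lra.
Qed.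

Lemma Csqrt_nonneg (x : R) : 0 <= x -> Csqrt (RtoC x) = RtoC (sqrt x).
Proof.
intros Hx. unfold Csqrt. change (Cnorm (RtoC x)) with (Cmod (RtoC x)).
rewrite Cmod_R, Rabs_pos_eq by exact Hx. simpl.
replace ((x + x) / 2) with x by field. replace ((x - x) / 2) with 0 by field.
rewrite sqrt_0, Rmult_0_r. reflexivity.
Qed.

(** With s, t the roots of z and z + h, the remainder is exactly -h^2 / (2 s (t + s)^2). As Re t >=
    0 and Re s = c > 0, both |s| and |t + s| are at least c, so the bound is quadratic without
    appeal to continuity of the root. *)
Lemma cdiff_sqrt (z : C) : 0 < fst z -> cdiff Csqrt z (/ (2 * Csqrt z))%C.
Proof.
intros Hz. set (s := Csqrt z : C). set (c := fst s).
assert (Hc : 0 < c) by apply (Csqrt_re_gt_0 z Hz).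
assert (Re_le : forall u : C, fst u <= Cmod u).
{ intros u. eapply Rle_trans; [apply Rle_abs|apply Rabs_fst_le]. }
apply cdiff_quadratic with (K := / (2 * c ^ 3)) (r := 1).
- lra.
- left. apply Rinv_0_lt_compat. apply Rmult_lt_0_compat; [lra|apply pow_lt, Hc].
- intros h _. set (t := Csqrt (z + h)%C : C). fold s.
  assert (Es : (s * s)%C = z) by apply Csqrt_sqr.
  assert (Et : (t * t)%C = (z + h)%C) by apply Csqrt_sqr.
  assert (Ct : 0 <= fst t) by apply Csqrt_re_pos.
  assert (Ns : c <= Cmod s) by apply Re_le.
  assert (Nst : c <= Cmod (t + s)%C).
  { eapply Rle_trans; [|apply Re_le]. change (c <= fst t + c). lra. }
  assert (Ns0 : s <> 0%C) by (apply Cmod_gt_0; lra).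
  assert (Nst0 : (t + s)%C <> 0%C) by (apply Cmod_gt_0; lra).
  assert (N2 : (2 : C) <> 0%C) by (apply RtoC_neq_0; lra).
  assert (Eh : h = ((t - s) * (t + s))%C).
  { replace ((t - s) * (t + s))%C with (t * t - s * s)%C by ring. rewrite Es, Et. ring. }
  assert (Key : (t - s - / (2 * s) * h)%C = (- (h * h / ((t + s) * (t + s) * (2 * s))))%C).
  { rewrite Eh. field. split; assumption. }
  rewrite Key, Cmod_opp, Cmod_div by (repeat apply Cmult_neq_0; assumption).
  rewrite !Cmod_mult, Cmod_R, Rabs_pos_eq by lra.
  apply Rle_div_l; [repeat apply Rmult_lt_0_compat; lra|].
  assert (Bd : c * c * (2 * c) <= Cmod (t + s)%C * Cmod (t + s)%C * (2 * Cmod s)).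
  { repeat apply Rmult_le_compat; nra. }
  replace (Cmod h * Cmod h) with (/ (2 * c ^ 3) * Cmod h ^ 2 * (c * c * (2 * c))) by (field; lra).
  apply Rmult_le_compat_l; [|exact Bd].
  apply Rmult_le_pos; [|apply pow2_ge_0].
  left. apply Rinv_0_lt_compat. apply Rmult_lt_0_compat; [lra|apply pow_lt, Hc].
Qed.

(** For s the root, d = |s - 1| and e = |s + 1| satisfy d e = |z| and d + e >= 2, so d (2 - d) <=
    |z|, that is (1 - d)^2 >= 1 - |z|. The principal branch gives d <= e, hence d <= 1, which picks
    the right sign of 1 - d. *)
Lemma Csqrt_1p_bound (z : C) : Cmod z < 1 ->
  Cmod (Csqrt (1 + z) - 1)%C <= 1 - sqrt (1 - Cmod z).
Proof.
intros Hz. set (s := Csqrt (1 + z)%C : C).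
assert (Es : (s * s)%C = (1 + z)%C) by apply Csqrt_sqr.
assert (Cs : 0 <= fst s) by apply Csqrt_re_pos.
assert (Ez : Cmod (s - 1)%C * Cmod (s + 1)%C = Cmod z).
{ rewrite <- Cmod_mult. f_equal.
  replace ((s - 1) * (s + 1))%C with (s * s - 1)%C by ring. rewrite Es. ring. }
assert (Far : Cmod (s - 1)%C ^ 2 <= Cmod (s + 1)%C ^ 2).
{ rewrite !Cmod_sqr. destruct s as [a b]. simpl in *. nra. }
assert (T : 2 <= Cmod (s + 1)%C + Cmod (s - 1)%C).
{ assert (X := Cmod_triangle (s + 1) (- (s - 1))). rewrite Cmod_opp in X.
  replace (s + 1 + - (s - 1))%C with (RtoC 2) in X by ring.
  rewrite Cmod_R, Rabs_pos_eq in X by lra. exact X. }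
set (d := Cmod (s - 1)%C) in *. set (e := Cmod (s + 1)%C) in *.
assert (Pd : 0 <= d) by apply Cmod_ge_0. assert (Pe : 0 <= e) by apply Cmod_ge_0.
assert (Hde : d <= e) by nra.
assert (Hd : d <= 1) by nra.
assert (Q : sqrt (1 - Cmod z) <= 1 - d).
{ rewrite <- (sqrt_pow2 (1 - d)) by lra. apply sqrt_le_1_alt. nra. }
lra.
Qed.

Lemma SL_star_radius (alpha : R) : 0 <= alpha <= 1 / 3 ->
  is_Ne_radius (SL_star alpha) (4 * (2 - 3 * alpha) / (9 * (1 - alpha) ^ 2)).
Proof.
(* [k] is the value of sqrt(1 - r) at the radius r = 1 - k^2; alpha <= 1/3 amounts to k >= 0. *)
intros Ha. set (k := 1 - 2 / (3 * (1 - alpha))).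
assert (Hk1 : (1 - alpha) * (1 - k) = 2 / 3) by (unfold k; field; lra).
assert (Hk : 0 <= k < 1) by (split; nra).
replace (4 * (2 - 3 * alpha) / (9 * (1 - alpha) ^ 2)) with (1 - k ^ 2)
  by (unfold k; field; lra).
assert (Re1 : forall z : C, Cmod z < 1 -> 0 < fst (1 + z)%C).
{ intros z Hz. assert (A := Rabs_fst_le z). simpl.
  assert (B : Rabs (fst z) < 1) by lra. apply Rabs_lt_between in B. lra. }
assert (Ns : forall z : C, (Csqrt (1 + z) + 1)%C <> 0%C).
{ intros z E. assert (P := Csqrt_re_pos (1 + z)%C). apply (f_equal fst) in E.
  change (fst (Csqrt (1 + z)%C) + 1 = 0) in E. lra. }
assert (Phi : forall z : C, phi_L alpha z = (1 + (1 - alpha)%R * (Csqrt (1 + z) - 1))%C).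
{ intros z. change ((alpha + (1 - alpha)%R * Csqrt (1 + z))%C =
    (1 + (1 - alpha)%R * (Csqrt (1 + z) - 1))%C). rewrite RtoC_minus. ring. }
(* Rationalising (sqrt(1 + z) - 1)/z removes the singularity at the origin. *)
apply (Ne_radius_criterion (phi_L alpha) (fun z => (1 - alpha)%R * / (Csqrt (1 + z) + 1))%C).
- split; nra.
- intros z Hz. eexists. apply cdiff_mult; [apply cdiff_const|].
  apply (cdiff_comp Cinv (fun z => Csqrt (1 + z) + 1)%C).
  + apply cdiff_inv, Ns.
  + apply cdiff_plus; [|apply cdiff_const].
    apply (cdiff_comp Csqrt (fun z => 1 + z)%C).
    * apply cdiff_sqrt, Re1, Hz.
    * apply cdiff_plus; [apply cdiff_const|apply cdiff_id].
- intros z Hz. rewrite Phi. assert (N := Ns z). assert (E := Csqrt_sqr (1 + z)%C).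
  set (s := Csqrt (1 + z)%C : C) in *.
  replace z with (s * s - 1)%C by (rewrite E; ring). field. exact N.
- intros z Hz. rewrite Phi.
  replace (1 + (1 - alpha)%R * (Csqrt (1 + z) - 1) - 1)%C with
    ((1 - alpha)%R * (Csqrt (1 + z) - 1))%C by ring.
  rewrite Cmod_mult, Cmod_R, Rabs_pos_eq by lra.
  assert (B := Csqrt_1p_bound z ltac:(nra)).
  assert (K : k < sqrt (1 - Cmod z)).
  { rewrite <- (sqrt_pow2 k) by lra. apply sqrt_lt_1_alt. nra. }
  nra.
- intros t Ht. exists (- t), (- ((1 - alpha) * (1 - sqrt (1 - t)))).
  assert (K : sqrt (1 - t) <= k).
  { rewrite <- (sqrt_pow2 k) by lra. apply sqrt_le_1_alt. lra. }
  pose proof (sqrt_pos (1 - t)).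
  split; [rewrite Rabs_Ropp; apply Rabs_pos_eq; nra|split].
  + rewrite Phi. rewrite <- RtoC_plus, Csqrt_nonneg by lra.
    replace (1 + - t) with (1 - t) by ring.
    rewrite <- RtoC_minus, <- RtoC_mult, <- RtoC_plus.
    unfold RtoC. f_equal. ring.
  + rewrite Rabs_Ropp, Rabs_pos_eq; nra.
Qed.

(** * Growth of the exponential and the class [Se_star] *)

Lemma increasing_of_deriv (f df : R -> R) (a b : R) :
  (forall t, is_derive f t (df t)) -> (forall t, a <= t -> 0 <= df t) -> a <= b -> f a <= f b.
Proof.
intros Hd Hp Hab. destruct (MVT_gen f a b df) as [c [Hc E]].
- intros t _. apply Hd.
- intros t _. apply continuity_pt_filterlim, (ex_derive_continuous (V := R_NormedModule)).
  eexists; apply Hd.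
- rewrite Rmin_left in Hc by exact Hab. assert (0 <= df c) by (apply Hp; lra).
  assert (0 <= df c * (b - a)) by (apply Rmult_le_pos; lra). lra.
Qed.

(** The second derivative e^t + e^-t - 2 is nonnegative by e^u >= 1 + u, and the first derivative
    vanishes at 0. *)
Lemma cosh_sub_sqr_increasing (a b : R) : 0 <= a <= b ->
  exp a + exp (- a) - a ^ 2 <= exp b + exp (- b) - b ^ 2.
Proof.
intros Hab.
apply (increasing_of_deriv (fun t => exp t + exp (- t) - t ^ 2)
  (fun t => exp t - exp (- t) - 2 * t)); [| |lra].
- intros t. auto_derive; [exact I|]. ring.
- intros t Ht.
  assert (X : exp 0 - exp (- 0) - 2 * 0 <= exp t - exp (- t) - 2 * t).
  { apply (increasing_of_deriv (fun t => exp t - exp (- t) - 2 * t)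
      (fun t => exp t + exp (- t) - 2)); [| |lra].
    - intros u. auto_derive; [exact I|]. ring.
    - intros u _. pose proof (exp_ineq1_le u). pose proof (exp_ineq1_le (- u)). lra. }
  rewrite Ropp_0, exp_0 in X. lra.
Qed.

Lemma one_sub_cos_le (y : R) : 2 * (1 - cos y) <= y ^ 2.
Proof.
assert (Pos : forall t, 0 <= t -> 2 * (1 - cos t) <= t ^ 2).
{ intros t Ht.
  assert (X : 0 ^ 2 - 2 * (1 - cos 0) <= t ^ 2 - 2 * (1 - cos t)).
  { apply (increasing_of_deriv (fun t => t ^ 2 - 2 * (1 - cos t)) (fun t => 2 * (t - sin t)));
      [| |exact Ht].
    - intros u. auto_derive; [exact I|]. ring.
    - intros u Hu.
      assert (Y : 0 - sin 0 <= u - sin u).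
      { apply (increasing_of_deriv (fun t => t - sin t) (fun t => 1 - cos t)); [| |exact Hu].
        - intros v. auto_derive; [exact I|]. ring.
        - intros v _. pose proof (COS_bound v). lra. }
      rewrite sin_0 in Y. lra. }
  rewrite cos_0 in X. lra. }
destruct (Rle_dec 0 y) as [Hy|Hy]; [apply Pos, Hy|].
rewrite <- cos_neg. replace (y ^ 2) with ((- y) ^ 2) by ring. apply Pos. lra.
Qed.

(* With [E t = e^t + e^-t - 2] one has [(e^t - 1)^2 = e^t E t]; the bound follows from
   [|e^z - 1|^2 <= e^x (E x + y^2)] and the monotonicity of [E t - t^2]. *)
Lemma Cexp_sub_1_bound (z : C) : Cmod (Cexp z - 1)%C <= exp (Cmod z) - 1.
Proof.
destruct z as [x y].
assert (Hm : Cmod (x, y) ^ 2 = x ^ 2 + y ^ 2) by apply (Cmod_sqr (x, y)).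
assert (Hx := Rabs_fst_le (x, y)). simpl fst in Hx.
assert (Hr : 0 <= Cmod (x, y)) by apply Cmod_ge_0.
set (r := Cmod (x, y)) in *.
assert (Er : 0 <= exp r - 1) by (pose proof (exp_ineq1_le r); lra).
assert (Inv : forall t, exp t * exp (- t) = 1).
{ intros t. rewrite <- exp_plus, Rplus_opp_r. apply exp_0. }
assert (Sq : Cmod (Cexp (x, y) - 1)%C ^ 2 <= (exp r - 1) ^ 2).
{ rewrite Cmod_sqr.
  change (fst (Cexp (x, y) - 1)%C) with (exp x * cos y + - (1)).
  change (snd (Cexp (x, y) - 1)%C) with (exp x * sin y + - 0).
  pose proof (sin2_cos2 y) as SC. unfold Rsqr in SC.
  assert (Q1 : (exp x * cos y + - (1)) ^ 2 + (exp x * sin y + - 0) ^ 2 =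
     exp x * (exp x + exp (- x) - 2 + 2 * (1 - cos y))).
  { replace ((exp x * cos y + - (1)) ^ 2 + (exp x * sin y + - 0) ^ 2) with
      (exp x * exp x * (sin y * sin y + cos y * cos y) - 2 * exp x * cos y + 1) by ring.
    rewrite SC. replace (exp x * (exp x + exp (- x) - 2 + 2 * (1 - cos y))) with
      (exp x * exp x + exp x * exp (- x) - 2 * exp x * cos y) by ring.
    rewrite Inv. ring. }
  assert (Q2 : (exp r - 1) ^ 2 = exp r * (exp r + exp (- r) - 2)).
  { replace (exp r * (exp r + exp (- r) - 2)) with
      (exp r * exp r + exp r * exp (- r) - 2 * exp r) by ring.
    rewrite Inv. ring. }
  rewrite Q1, Q2.
  assert (Mono := cosh_sub_sqr_increasing (Rabs x) r (conj (Rabs_pos x) Hx)).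
  assert (Ev : exp (Rabs x) + exp (- Rabs x) = exp x + exp (- x)).
  { unfold Rabs. destruct (Rcase_abs x); [rewrite Ropp_involutive|]; ring. }
  rewrite Ev, pow2_abs in Mono.
  pose proof (one_sub_cos_le y) as Cy. pose proof (COS_bound y) as CB.
  apply Rmult_le_compat.
  - left. apply exp_pos.
  - pose proof (exp_ineq1_le x). pose proof (exp_ineq1_le (- x)). lra.
  - pose proof (Rle_abs x). destruct (Req_dec x r) as [E|N]; [rewrite E; lra|].
    left. apply exp_increasing. lra.
  - lra. }
pose proof (Cmod_ge_0 (Cexp (x, y) - 1)%C). nra.
Qed.

Lemma Cexp_real (x : R) : Cexp (RtoC x) = RtoC (exp x).
Proof.
unfold Cexp, RtoC. simpl. rewrite cos_0, sin_0, Rmult_1_r, Rmult_0_r. reflexivity.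
Qed.

Lemma Se_star_radius (alpha : R) : 0 <= alpha <= (3 * exp 1 - 5) / (3 * exp 1 - 3) ->
  is_Ne_radius (Se_star alpha) (ln ((5 - 3 * alpha) / (3 - 3 * alpha))).
Proof.
intros Ha. assert (He : 2 < exp 1) by (pose proof (exp_ineq1 1); lra).
assert (Ha1 : alpha * (3 * exp 1 - 3) <= 3 * exp 1 - 5) by (apply Rle_div_r; lra).
assert (Ha2 : alpha < 1) by nra.
(* [q] is the value of e^r at the radius, from (1 - alpha)(q - 1) = 2/3; the upper bound on alpha
   says q <= e, that is r <= 1. *)
set (q := (5 - 3 * alpha) / (3 - 3 * alpha)).
assert (Hq : (1 - alpha) * (q - 1) = 2 / 3) by (unfold q; field; lra).
assert (Hq1 : 1 < q) by nra.
set (r := ln q).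
assert (Er : exp r = q) by (apply exp_ln; lra).
assert (Hr0 : 0 < r) by (rewrite <- ln_1; apply ln_increasing; lra).
assert (Hr1 : r <= 1).
{ rewrite <- (ln_exp 1). apply ln_le; [lra|]. unfold q. apply Rle_div_l; lra. }
assert (Phi : forall z : C, phi_e alpha z = (1 + (1 - alpha)%R * (Cexp z - 1))%C).
{ intros z. change ((alpha + (1 - alpha)%R * Cexp z)%C =
    (1 + (1 - alpha)%R * (Cexp z - 1))%C). rewrite RtoC_minus. ring. }
apply (Ne_radius_criterion (phi_e alpha) (fun z => (1 - alpha)%R *
  (if Req_EM_T (Cmod z) 0 then 1%C else ((Cexp z - 1) / z)%C))%C).
- split; assumption.
- intros z Hz. destruct (classic (z = 0%C)) as [->|N].
  + eexists. apply cdiff_mult; [apply cdiff_const|apply cdiff_expm1_div].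
  + destruct (cdiff_div_id (fun z => Cexp z + - (1))%C 1%C z _ N
      (cdiff_plus _ _ _ _ _ (cdiff_exp z) (cdiff_const (- (1))%C z))) as [M HM].
    eexists. apply cdiff_mult; [apply cdiff_const|exact HM].
- intros z Hz. rewrite Phi. destruct (Req_EM_T (Cmod z) 0) as [E|N].
  + apply Cmod_eq_0 in E. subst z. rewrite Cexp_0. ring.
  + assert (Nz : z <> 0%C) by (intros ->; rewrite Cmod_0 in N; lra). field. exact Nz.
- intros z Hz. rewrite Phi.
  replace (1 + (1 - alpha)%R * (Cexp z - 1) - 1)%C with
    ((1 - alpha)%R * (Cexp z - 1))%C by ring.
  rewrite Cmod_mult, Cmod_R, Rabs_pos_eq by lra.
  assert (B := Cexp_sub_1_bound z). assert (X := exp_increasing _ _ Hz). nra.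
- intros t Ht. exists t, ((1 - alpha) * (exp t - 1)).
  assert (X := exp_increasing _ _ (proj1 Ht)).
  split; [apply Rabs_pos_eq; lra|split].
  + rewrite Phi, Cexp_real. rewrite <- RtoC_minus, <- RtoC_mult, <- RtoC_plus. reflexivity.
  + rewrite Rabs_pos_eq; nra.
Qed.

Theorem mainTheorem6 :
  (forall alpha : R, 0 <= alpha < 1 ->
     is_Ne_radius (BS_star alpha) (4 / (3 + sqrt (9 + 16 * alpha)))) /\
  (forall alpha : R, 0 <= alpha <= 1 / 3 ->
     is_Ne_radius (SL_star alpha) (4 * (2 - 3 * alpha) / (9 * (1 - alpha) ^ 2))) /\
  is_Ne_radius (SL_star 0) (8 / 9) /\
  (forall alpha : R, 0 <= alpha <= (3 * exp 1 - 5) / (3 * exp 1 - 3) ->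
     is_Ne_radius (Se_star alpha) (ln ((5 - 3 * alpha) / (3 - 3 * alpha)))) /\
  is_Ne_radius (Se_star 0) (ln (5 / 3)).
Proof.
split; [exact BS_star_radius|]. split; [exact SL_star_radius|]. split.
{ replace (8 / 9) with (4 * (2 - 3 * 0) / (9 * (1 - 0) ^ 2)) by field.
  apply SL_star_radius. lra. }
split; [exact Se_star_radius|].
replace (5 / 3) with ((5 - 3 * 0) / (3 - 3 * 0)) by field.
apply Se_star_radius. split; [lra|].
assert (2 < exp 1) by (pose proof (exp_ineq1 1); lra).
apply Rdiv_le_0_compat; lra.
Qed.
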